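(* Let $M\geq N\ge 1$ be natural numbers, let $x_1,x_2$ be nonzero complex numbers such that $x_1^{2MN}n^{2M}+(-1)^{M-1}x_2^{2MN}k^{2N}\neq0$ for all natural numbers $n,k\geq1$, and let $t$ be an arbitrary complex number such that all terms below are defined (in particular $t\ne0$). Then $$\frac{\pi x_2^{N-2MN}}{Mx_1^{N-2MN}(1-e^{\frac{i\pi}{M}})}\sum_{n=1}^{\infty}\frac{1}{n^{2N-\frac NM}\left(n^{2N}-\frac{t^{2MN}}{x_2^{2MN}}\right)}+\frac{\pi x_2^{N-2MN}}{Mx_1^{N-2MN}}\sum_{r=0}^{M-1}e^{\frac{ir\pi}{M}}\sum_{n=1}^{\infty}\frac{1}{n^{2N-\frac NM}\left(n^{2N}-\frac{t^{2MN}}{x_2^{2MN}}\right)\left(\exp\left(2\pi n^{\frac NM}e^{\frac{ir\pi}{M}}\frac{x_2^N}{x_1^N}\right)-1\right)}$$ $$+e^{\frac{i\pi(M-N)}{2N}}\frac{\pi x_1^{M-2MN}}{Nx_2^{M-2MN}(1-e^{\frac{i\pi}{N}})}\sum_{n=1}^{\infty}\frac{1}{n^{2M-\frac MN}\left(n^{2M}+(-1)^{M-1}\frac{t^{2MN}}{x_1^{2MN}}\right)}$$ $$+e^{\frac{i\pi(M-N)}{2N}}\frac{\pi x_1^{M-2MN}}{Nx_2^{M-2MN}}\sum_{r=0}^{N-1}e^{\frac{ir\pi}{N}}\sum_{n=1}^{\infty}\frac{1}{n^{2M-\frac MN}\left(n^{2M}+(-1)^{M-1}\frac{t^{2MN}}{x_1^{2MN}}\right)\left(\exp\left(2\pi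 n^{\frac MN}e^{\frac{i\pi}{N}\left(r+\frac M2-\frac N2\right)}\frac{x_1^M}{x_2^M}\right)-1\right)}$$ $$=\frac{x_1^{2MN}x_2^{2MN}}{4t^{4MN}}+\frac{x_2^{2MN}(2\pi)^{2M}B_{2M}}{4t^{2MN}(2M)!}+\frac{x_1^{2MN}(-1)^N(2\pi)^{2N}B_{2N}}{4t^{2MN}(2N)!}$$ $$-\frac{\pi^2x_1^{2MN-N}x_2^{2MN-M}}{4MN\,t^{4MN-N-M}}\left\{\sum_{r=0}^{M-1}e^{\frac{ir\pi}{M}}\coth\left(\frac{\pi t^Ne^{\frac{ir\pi}{M}}}{x_1^N}\right)\right\}\left\{\sum_{r=0}^{N-1}e^{\frac{ir\pi}{N}}\cot\left(\frac{\pi t^Me^{\frac{ir\pi}{N}}}{x_2^M}\right)\right\},$$ provided that the series on the left-hand side converge absolutely.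
   Context: $B_{2k}$ denotes the Bernoulli numbers ($\frac{z}{e^z-1}=\sum_{k\ge0}B_kz^k/k!$), $i=\sqrt{-1}$, and $n^{N/M}$, $n^{M/N}$ denote positive real powers of the positive integer $n$. *)

(* Defs.v *)
(* Stdlib real numbers with Coquelicot's complex numbers and series. *)
From Stdlib Require Import Reals ZArith.
From Coquelicot Require Import Coquelicot.

Open Scope C_scope.

Definition Cexp (z : C) : C :=
  ((exp (Re z) * cos (Im z))%R, (exp (Re z) * sin (Im z))%R).

Definition Ccosh (z : C) : C := (Cexp z + Cexp (- z)) / 2.
Definition Csinh (z : C) : C := (Cexp z - Cexp (- z)) / 2.
Definition Ccoth (z : C) : C := Ccosh z / Csinh z.

Definition Ccos (z : C) : C := (Cexp (Ci * z) + Cexp (- (Ci * z))) / 2.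
Definition Csin (z : C) : C := (Cexp (Ci * z) - Cexp (- (Ci * z))) / (2 * Ci).
Definition Ccot (z : C) : C := Ccos z / Csin z.

Definition Cpowz (z : C) (k : Z) : C :=
  match k with
  | Z0 => 1
  | Zpos p => z ^ Pos.to_nat p
  | Zneg p => / (z ^ Pos.to_nat p)
  end.

(* Sum of a complex series, total like Coquelicot's [Series]; it is meaningful
   only when the series converges (see [CSeries_unique]). *)
Definition CSeries (a : nat -> C) : C :=
  (Series (fun n => Re (a n)), Series (fun n => Im (a n))).

Lemma CSeries_unique (a : nat -> C) (l : C) :
  is_series (V := C_NormedModule) a l -> CSeries a = l.
Proof.
  intros H.
  assert (HS : forall n, sum_n a n =
     (sum_n (fun k => Re (a k)) n, sum_n (fun k => Im (a k)) n)).
  { intros n; induction n as [|n IH].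
    - rewrite !sum_O; destruct (a 0%nat); reflexivity.
    - rewrite !sum_Sn, IH; reflexivity. }
  assert (Hb : forall eps : posreal, eventually (fun n =>
     ball l eps (sum_n a n))).
  { intros eps.
    apply (H (fun y : C => ball l eps y)), locally_ball. }
  unfold CSeries; destruct l as [lr li]; f_equal; apply is_series_unique;
    apply filterlim_locally; intros eps; destruct (Hb eps) as [n0 Hn];
    exists n0; intros n Hnn; specialize (Hn n Hnn); rewrite HS in Hn;
    destruct Hn as [Hr Hi]; assumption.
Qed.

(* [Csum_ge1 a] is the sum of [a n] over [n >= 1]. *)
Definition Csum_ge1 (a : nat -> C) : C := CSeries (fun n => a (S n)).

Definition abs_convergent_ge1 (a : nat -> C) : Prop :=
  ex_series (fun n => Cmod (a (S n))).

(* [Csum_lt m f] is the sum of [f r] over [0 <= r < m]. *)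
Fixpoint Csum_lt (m : nat) (f : nat -> C) : C :=
  match m with
  | O => 0
  | S p => Csum_lt p f + f p
  end.

(* z / (e^z - 1) = sum_k B_k z^k / k! in a punctured neighbourhood of 0; this
   determines the sequence B uniquely. *)
Definition is_bernoulli (B : nat -> R) : Prop :=
  exists rho : posreal, forall z : C, z <> 0 -> (Cmod z < rho)%R ->
    is_series (V := C_NormedModule)
      (fun k => B k * z ^ k / INR (fact k)) (z / (Cexp z - 1)).

(* Below, n ranges over the positive integers, so that [Rpower (INR n) _] is the
   positive real power. *)

Definition pole1 (M N : nat) (x2 t : C) (n : nat) : C :=
  INR n ^ (2 * N) - t ^ (2 * M * N) / x2 ^ (2 * M * N).

Definition pole2 (M N : nat) (x1 t : C) (n : nat) : C :=
  INR n ^ (2 * M) + (-1) ^ (M - 1) * (t ^ (2 * M * N) / x1 ^ (2 * M * N)).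

Definition lambert1 (M N : nat) (x1 x2 : C) (r n : nat) : C :=
  Cexp (2 * PI * Rpower (INR n) (INR N / INR M)
        * Cexp (Ci * INR r * PI / INR M) * (x2 ^ N / x1 ^ N)) - 1.

Definition lambert2 (M N : nat) (x1 x2 : C) (r n : nat) : C :=
  Cexp (2 * PI * Rpower (INR n) (INR M / INR N)
        * Cexp (Ci * PI / INR N * (INR r + INR M / 2 - INR N / 2))
        * (x1 ^ M / x2 ^ M)) - 1.

Definition coth_arg (M N : nat) (x1 t : C) (r : nat) : C :=
  PI * t ^ N * Cexp (Ci * INR r * PI / INR M) / x1 ^ N.

Definition cot_arg (M N : nat) (x2 t : C) (r : nat) : C :=
  PI * t ^ M * Cexp (Ci * INR r * PI / INR N) / x2 ^ M.

Definition summand1 (M N : nat) (x2 t : C) (n : nat) : C :=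
  1 / (Rpower (INR n) (2 * INR N - INR N / INR M) * pole1 M N x2 t n).

Definition summand2 (M N : nat) (x1 x2 t : C) (r n : nat) : C :=
  1 / (Rpower (INR n) (2 * INR N - INR N / INR M) * pole1 M N x2 t n
       * lambert1 M N x1 x2 r n).

Definition summand3 (M N : nat) (x1 t : C) (n : nat) : C :=
  1 / (Rpower (INR n) (2 * INR M - INR M / INR N) * pole2 M N x1 t n).

Definition summand4 (M N : nat) (x1 x2 t : C) (r n : nat) : C :=
  1 / (Rpower (INR n) (2 * INR M - INR M / INR N) * pole2 M N x1 t n
       * lambert2 M N x1 x2 r n).

Record terms_defined (M N : nat) (x1 x2 t : C) : Prop := {
  td_t : t <> 0;
  td_pole1 : forall n, (1 <= n)%nat -> pole1 M N x2 t n <> 0;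
  td_pole2 : forall n, (1 <= n)%nat -> pole2 M N x1 t n <> 0;
  td_lambert1 : forall r n, (r < M)%nat -> (1 <= n)%nat ->
    lambert1 M N x1 x2 r n <> 0;
  td_lambert2 : forall r n, (r < N)%nat -> (1 <= n)%nat ->
    lambert2 M N x1 x2 r n <> 0;
  td_coth : forall r, (r < M)%nat -> Csinh (coth_arg M N x1 t r) <> 0;
  td_cot : forall r, (r < N)%nat -> Csin (cot_arg M N x2 t r) <> 0
}.

Record lhs_abs_convergent (M N : nat) (x1 x2 t : C) : Prop := {
  lac_1 : abs_convergent_ge1 (summand1 M N x2 t);
  lac_2 : forall r, (r < M)%nat -> abs_convergent_ge1 (summand2 M N x1 x2 t r);
  lac_3 : abs_convergent_ge1 (summand3 M N x1 t);
  lac_4 : forall r, (r < N)%nat -> abs_convergent_ge1 (summand4 M N x1 x2 t r)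
}.

(* Main.v *)
(** Grouping the partial fractions of the cotangent over the roots of unity
    [w ^ r], [w = exp (i pi / m)], gives
    [sum_(r < m) w^r pi cot (pi v w^r) = m / v - 2 m v^(2m-1) sum_n 1 / (n^(2m) - v^(2m))],
    and similarly for the hyperbolic cotangent.  Hence the product on the right-hand side
    of the theorem is, up to simple series and even zeta values, the double series of
    [1 / (P_k Q_n)], where [P_k = pole1 k] and [Q_n = pole2 n].  Moreover
    [1 / (P_k Q_n) = 1 / (P_k (n^(2M) - z_k)) + 1 / (Q_n (k^(2N) - y_n))] with [z_k]
    proportional to [k^(2N)] and [y_n] to [n^(2M)]; summing the first part over [n] and
    the second over [k] gives the Lambert-type series on the left.  The denominators
    [n^(2M) - z_k] may be arbitrarily small, but only for one [n] for each [k]; that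
    single term is controlled by the whole row, and the rows are summable against
    [1 / P_k] by the convergence hypothesis.  So the double series of the first part
    converges absolutely and the order of summation can be exchanged. *)

Require Import Defs.
From Stdlib Require Import Reals ZArith Lra Lia.
From Coquelicot Require Import Coquelicot.

Open Scope C_scope.

(** No bound on the double series of the second part is needed: in each column that part is
    recovered as [1 / (P_k Q_n)] minus the first part. Exchanging the first part alone thus gives:
    row total plus column total equals the product of the sums of [1 / P_k] and of [1 / Q_n]. The
    theorem is this equality after evaluation of its terms.

    Each inner sum has a closed form in hyperbolic cotangents, and [coth u = 1 + 2 / (e^(2u) - 1)]
    splits it. The [1] yields a plain series, the fraction yields the Lambert-type series, and a
    leftover such as [1 / (k^(2N) P_k)] yields the zeta values. Rows and columns use the same closed
    form with [M] and [N] interchanged. Its natural sign for columns is [(-1)^N], whereas [Q_n]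
    requires [(-1)^M]; the factor [exp(i pi (M - N) / (2N))] of the statement corrects exactly this.

    Two classical inputs are proved here: the cotangent expansion, by Herglotz' trick, and Euler's
    even zeta values, by comparing two power series of [x coth (x / 2)] at real points. *)

Notation is_Cseries := (is_series (K := C_AbsRing) (V := C_NormedModule)).

(** * The complex exponential *)

Lemma Cexp_plus (a b : C) : Cexp (a + b) = Cexp a * Cexp b.
Proof.
  unfold Cexp; destruct a as [a1 a2], b as [b1 b2]; simpl.
  rewrite exp_plus, cos_plus, sin_plus; unfold Cmult; simpl; f_equal; ring.
Qed.

Lemma Cexp_RtoC (x : R) : Cexp x = exp x.
Proof. unfold Cexp; simpl; rewrite cos_0, sin_0; unfold RtoC; f_equal; ring. Qed.

Lemma Cexp_0 : Cexp 0 = 1.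
Proof. now rewrite Cexp_RtoC, exp_0. Qed.

Lemma Cexp_opp_mul (z : C) : Cexp z * Cexp (- z) = 1.
Proof. rewrite <- Cexp_plus, <- Cexp_0; f_equal; ring. Qed.

Lemma Cexp_neq_0 (z : C) : Cexp z <> 0.
Proof.
  intros H; apply C1_nz; rewrite <- (Cexp_opp_mul z), H; ring.
Qed.

Lemma Cexp_opp (z : C) : Cexp (- z) = / Cexp z.
Proof.
  assert (H := Cexp_neq_0 z).
  replace (Cexp (- z)) with (Cexp z * Cexp (- z) / Cexp z) by (field; auto).
  rewrite Cexp_opp_mul; field; auto.
Qed.

Lemma Cexp_pow (z : C) (n : nat) : Cexp z ^ n = Cexp (INR n * z).
Proof.
  induction n as [|n IH]; rewrite ?S_INR, ?RtoC_plus; simpl Cpow.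
  - simpl; rewrite Cmult_0_l; now rewrite Cexp_0.
  - rewrite IH, <- Cexp_plus; f_equal; ring.
Qed.

Lemma Cexp_Ci_PI : Cexp (Ci * PI) = -1.
Proof.
  unfold Cexp; simpl. replace (0 * PI - 1 * 0)%R with 0%R by ring.
  replace (0 * 0 + 1 * PI)%R with PI by ring.
  rewrite exp_0, cos_PI, sin_PI. unfold RtoC; f_equal; ring.
Qed.

Lemma Cmod_im_le (z : C) : (Rabs (Im z) <= Cmod z)%R.
Proof. eapply Rle_trans; [apply Rmax_r | apply Rmax_Cmod]. Qed.

Lemma INR_S_neq_0 (n : nat) : RtoC (INR (S n)) <> 0.
Proof. intros H; apply (not_0_INR (S n)); [lia | now apply RtoC_inj]. Qed.

Lemma INR_pos_neq_0 (n : nat) : (1 <= n)%nat -> RtoC (INR n) <> 0.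
Proof. destruct n; [lia | intros _; apply INR_S_neq_0]. Qed.

(** * Complex series *)

Lemma sum_n_Re_Im (a : nat -> C) (n : nat) :
  sum_n a n
  = (sum_n (fun k => Re (a k)) n, sum_n (fun k => Im (a k)) n).
Proof.
  induction n as [|n IH].
  - rewrite !sum_O; destruct (a 0%nat); reflexivity.
  - rewrite !sum_Sn, IH; reflexivity.
Qed.

Lemma is_Cseries_Re_Im (a : nat -> C) (l : C) :
  is_Cseries a l <->
  is_series (fun n => Re (a n)) (Re l) /\ is_series (fun n => Im (a n)) (Im l).
Proof.
  split.
  - intros H; split; apply filterlim_locally; intros eps;
      destruct (H (fun y : C => ball l eps y) (locally_ball _ _)) as [n0 Hn];
      exists n0; intros n Hnn; specialize (Hn n Hnn);
      change (ball l eps (sum_n a n)) in Hn; rewrite sum_n_Re_Im in Hn; apply Hn.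
  - intros [Hr Hi]. apply filterlim_locally; intros eps.
    destruct (Hr _ (locally_ball _ eps)) as [n0 Hn0].
    destruct (Hi _ (locally_ball _ eps)) as [n1 Hn1].
    exists (n0 + n1)%nat; intros n Hn.
    change (ball l eps (sum_n a n)); rewrite sum_n_Re_Im.
    split; [apply Hn0 | apply Hn1]; lia.
Qed.

Lemma is_Cseries_unique (a : nat -> C) (l1 l2 : C) :
  is_Cseries a l1 -> is_Cseries a l2 -> l1 = l2.
Proof. intros H1 H2; now rewrite <- (CSeries_unique _ _ H1), (CSeries_unique _ _ H2). Qed.

Lemma is_Cseries_plus (a b : nat -> C) (la lb : C) :
  is_Cseries a la -> is_Cseries b lb -> is_Cseries (fun n => a n + b n) (la + lb).
Proof. exact (is_series_plus (V := C_NormedModule) a b la lb). Qed.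

Lemma is_Cseries_scal (c : C) (a : nat -> C) (l : C) :
  is_Cseries a l -> is_Cseries (fun n => c * a n) (c * l).
Proof. exact (is_series_scal (V := C_NormedModule) c a l). Qed.

Lemma is_Cseries_ext (a b : nat -> C) (l : C) :
  (forall n, a n = b n) -> is_Cseries a l -> is_Cseries b l.
Proof. exact (is_series_ext (V := C_NormedModule) a b l). Qed.

Lemma is_Cseries_abs (a : nat -> C) :
  ex_series (fun n => Cmod (a n)) -> is_Cseries a (CSeries a).
Proof.
  intros H.
  destruct (ex_series_le (V := C_CompleteNormedModule) a (fun n => Cmod (a n))) as [l Hl];
    [intros n; apply Rle_refl | exact H |].
  change (is_Cseries a l) in Hl. now rewrite (CSeries_unique _ _ Hl).
Qed.

Lemma is_Cseries_RtoC (a : nat -> R) (l : R) :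
  is_series a l -> is_Cseries (fun n => RtoC (a n)) (RtoC l).
Proof.
  intros H; apply is_Cseries_Re_Im; split; [exact H|]; simpl.
  apply filterlim_ext with (fun _ : nat => 0%R); [|apply filterlim_const].
  intros n; rewrite sum_n_const; ring.
Qed.

(** * Finite sums *)

Lemma Csum_lt_ext (m : nat) (f g : nat -> C) :
  (forall r, (r < m)%nat -> f r = g r) -> Csum_lt m f = Csum_lt m g.
Proof.
  induction m as [|m IH]; simpl; intros H; [reflexivity|].
  rewrite IH, H; [reflexivity | lia | intros; apply H; lia].
Qed.

Lemma Csum_lt_plus (m : nat) (f g : nat -> C) :
  Csum_lt m (fun r => f r + g r) = Csum_lt m f + Csum_lt m g.
Proof. induction m as [|m IH]; simpl; [|rewrite IH]; ring. Qed.

Lemma Csum_lt_scal (m : nat) (c : C) (f : nat -> C) :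
  Csum_lt m (fun r => c * f r) = c * Csum_lt m f.
Proof. induction m as [|m IH]; simpl; [|rewrite IH]; ring. Qed.

Lemma Csum_lt_const (m : nat) (c : C) : Csum_lt m (fun _ => c) = INR m * c.
Proof.
  induction m as [|m IH]; [simpl; ring|].
  rewrite S_INR, RtoC_plus; simpl; rewrite IH; ring.
Qed.

Lemma is_Cseries_Csum_lt (m : nat) (a : nat -> nat -> C) (l : nat -> C) :
  (forall r, (r < m)%nat -> is_Cseries (a r) (l r)) ->
  is_Cseries (fun n => Csum_lt m (fun r => a r n)) (Csum_lt m l).
Proof.
  induction m as [|m IH]; simpl; intros H.
  - apply (is_Cseries_ext (fun n => RtoC 0)); [reflexivity|].
    apply is_Cseries_RtoC.
    apply filterlim_ext with (fun _ : nat => 0%R); [|apply filterlim_const].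
    intros n; rewrite sum_n_const; ring.
  - apply is_Cseries_plus; [apply IH; intros; apply H; lia | apply H; lia].
Qed.

(** * Double series *)

Lemma sum_n_le_compat (a b : nat -> R) (K : nat) :
  (forall n, (n <= K)%nat -> (a n <= b n)%R) -> (sum_n a K <= sum_n b K)%R.
Proof.
  induction K as [|K IH]; intros H; [rewrite !sum_O; auto|].
  rewrite !sum_Sn; apply Rplus_le_compat; auto.
Qed.

Lemma sum_n_nonneg (a : nat -> R) (K : nat) :
  (forall n, 0 <= a n)%R -> (0 <= sum_n a K)%R.
Proof.
  intros H; induction K as [|K IH]; [rewrite sum_O; auto|].
  rewrite sum_Sn; unfold plus; simpl; specialize (H (S K)); lra.
Qed.

Lemma sum_n_incr (a : nat -> R) (m n : nat) :
  (forall k, 0 <= a k)%R -> (m <= n)%nat -> (sum_n a m <= sum_n a n)%R.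
Proof.
  intros H Hmn; induction Hmn as [|n Hmn IH]; [apply Rle_refl|].
  rewrite sum_Sn; unfold plus; simpl; specialize (H (S n)); lra.
Qed.

Lemma sum_n_Rmult_l (c : R) (a : nat -> R) (K : nat) :
  sum_n (fun n => c * a n)%R K = (c * sum_n a K)%R.
Proof. exact (sum_n_scal_l (K := R_AbsRing) (V := R_ModuleSpace) c a K). Qed.

Lemma sum_n_le_series (a : nat -> R) (l : R) (K : nat) :
  (forall k, 0 <= a k)%R -> is_series a l -> (sum_n a K <= l)%R.
Proof.
  intros H Hl; apply (is_lim_seq_incr_compare (sum_n a) l Hl).
  intros n; apply sum_n_incr; auto.
Qed.

Lemma ex_series_bounded (a : nat -> R) (S : R) :
  (forall k, 0 <= a k)%R -> (forall K, sum_n a K <= S)%R ->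
  ex_series a /\ (Series a <= S)%R.
Proof.
  intros H HS.
  destruct (ex_finite_lim_seq_incr (sum_n a) S) as [l Hl]; auto.
  - intros n; apply sum_n_incr; auto.
  - split; [now exists l|].
    rewrite (is_series_unique a l Hl).
    exact (is_lim_seq_le (sum_n a) (fun _ => S) l S HS Hl (is_lim_seq_const S)).
Qed.

Lemma is_series_sum_n (a : nat -> nat -> R) (l : nat -> R) (K : nat) :
  (forall n, is_series (a n) (l n)) ->
  is_series (fun k => sum_n (fun n => a n k) K) (sum_n l K).
Proof.
  intros H; induction K as [|K IH].
  - rewrite sum_O; apply is_series_ext with (a 0%nat); [|apply H].
    intros n; now rewrite sum_O.
  - rewrite sum_Sn.
    apply is_series_ext with (fun k => plus (sum_n (fun n => a n k) K) (a (S K) k)).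
    + intros n; now rewrite sum_Sn.
    + apply (is_series_plus (V := R_NormedModule)); auto.
Qed.

(** For fixed [K] the sum of the first rows is the limit in [L] of rectangle sums, so the row totals
    inherit the bound [S]. *)
Lemma fubini_nonneg_le (a : nat -> nat -> R) (S : R) :
  (forall n k, 0 <= a n k)%R ->
  (forall K L, sum_n (fun n => sum_n (a n) L) K <= S)%R ->
  (forall n, ex_series (a n)) /\ ex_series (fun n => Series (a n)).
Proof.
  intros H HS.
  assert (Hrow : forall n, ex_series (a n)).
  { intros n; apply (ex_series_bounded (a n) S); auto.
    intros L; eapply Rle_trans; [|apply (HS n L)].
    destruct n as [|n]; [rewrite sum_O; apply Rle_refl|].
    rewrite sum_Sn; unfold plus; simpl.
    assert (0 <= sum_n (fun m => sum_n (a m) L) n)%R; [|lra].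
    apply sum_n_nonneg; intros m; now apply sum_n_nonneg. }
  split; [exact Hrow|].
  apply (ex_series_bounded _ S).
  - intros n; eapply Rle_trans; [apply (H n 0%nat)|].
    rewrite <- (sum_O (a n)); apply sum_n_le_series; auto.
    now apply Series_correct.
  - intros K.
    assert (E : is_series (fun k => sum_n (fun n => a n k) K)
                          (sum_n (fun n => Series (a n)) K)).
    { apply is_series_sum_n; intros n; now apply Series_correct. }
    refine (is_lim_seq_le _ (fun _ => S) (Finite _) (Finite S) _ E (is_lim_seq_const S)).
    intros L; rewrite sum_n_switch; apply HS.
Qed.

Lemma fubini_nonneg (a : nat -> nat -> R) (S : R) :
  (forall n k, 0 <= a n k)%R ->
  (forall K L, sum_n (fun n => sum_n (a n) L) K <= S)%R ->
  exists l, is_series (fun n => Series (a n)) l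
         /\ is_series (fun k => Series (fun n => a n k)) l.
Proof.
  intros H HS.
  assert (HS' : forall K L, (sum_n (fun k => sum_n (fun n => a n k) L) K <= S)%R).
  { intros K L; rewrite sum_n_switch; apply HS. }
  destruct (fubini_nonneg_le a S H HS) as [Hr Er].
  destruct (fubini_nonneg_le (fun k n => a n k) S (fun k n => H n k) HS') as [Hc Ec].
  (* Only one inequality is proved, for a general array; applied to [a] and to its transpose it
     gives equality. *)
  assert (Hle : forall b : nat -> nat -> R, (forall n k, 0 <= b n k)%R ->
    (forall n, ex_series (b n)) -> ex_series (fun n => Series (b n)) ->
    (forall k, ex_series (fun n => b n k)) ->
    ex_series (fun k => Series (fun n => b n k)) ->
    (Series (fun k => Series (fun n => b n k)) <= Series (fun n => Series (b n)))%R).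
  { intros b Hb Hbr Ebr Hbc Ebc.
    apply (is_lim_seq_le (sum_n (fun k => Series (fun n => b n k)))
      (fun _ => Series (fun n => Series (b n)))
      (Series (fun k => Series (fun n => b n k))) (Series (fun n => Series (b n))));
      [| exact (Series_correct _ Ebc) | apply is_lim_seq_const].
    intros K.
    rewrite <- (is_series_unique _ _
      (is_series_sum_n (fun k n => b n k) (fun k => Series (fun n => b n k)) K
        (fun k => Series_correct _ (Hbc k)))).
    apply Series_le; auto. intros n; split.
    - now apply sum_n_nonneg.
    - apply sum_n_le_series; auto. now apply Series_correct. }
  exists (Series (fun n => Series (a n))); split; [now apply Series_correct|].
  replace (Series (fun n => Series (a n))) with (Series (fun k => Series (fun n => a n k))).
  - now apply Series_correct.
  - apply Rle_antisym; [now apply Hle|].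
    apply (Hle (fun k n => a n k)); auto.
Qed.

(** Reduction to nonnegative arrays through [a = (|a| + a) - |a|], where [|a| + a] lies between [0]
    and [2 |a|]. *)
Lemma fubini_R (a : nat -> nat -> R) (S : R) :
  (forall K L, sum_n (fun n => sum_n (fun k => Rabs (a n k)) L) K <= S)%R ->
  (forall n, ex_series (a n)) /\ (forall k, ex_series (fun n => a n k)) /\
  exists l, is_series (fun n => Series (a n)) l
         /\ is_series (fun k => Series (fun n => a n k)) l.
Proof.
  intros HS.
  set (b n k := Rabs (a n k)). set (c n k := (Rabs (a n k) + a n k)%R).
  assert (Hb : forall n k, (0 <= b n k)%R) by (intros; apply Rabs_pos).
  assert (Hc : forall n k, (0 <= c n k <= b n k + b n k)%R).
  { intros n k; unfold c, b; assert (H1 := Rle_abs (a n k)).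
    assert (H2 := Rle_abs (- a n k)); rewrite Rabs_Ropp in H2; lra. }
  assert (HSc : forall K L, (sum_n (fun n => sum_n (c n) L) K <= S + S)%R).
  { intros K L.
    eapply Rle_trans; [|apply Rplus_le_compat; apply (HS K L)].
    apply Rle_trans with
      (sum_n (fun n => sum_n (fun k => plus (b n k) (b n k)) L) K).
    - apply sum_n_le_compat; intros n _; apply sum_n_le_compat; intros k _; apply Hc.
    - right. rewrite <- (sum_n_plus (fun n => sum_n (b n) L)).
      apply sum_n_ext; intros n; now rewrite sum_n_plus. }
  assert (HS' : forall K L, (sum_n (fun k => sum_n (fun n => b n k) L) K <= S)%R).
  { intros K L; rewrite sum_n_switch; apply HS. }
  assert (HSc' : forall K L, (sum_n (fun k => sum_n (fun n => c n k) L) K <= S + S)%R).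
  { intros K L; rewrite sum_n_switch; apply HSc. }
  destruct (fubini_nonneg_le b S Hb HS) as [Rb _].
  destruct (fubini_nonneg_le (fun k n => b n k) S (fun k n => Hb n k) HS') as [Cb _].
  destruct (fubini_nonneg_le c (S + S) (fun n k => proj1 (Hc n k)) HSc) as [Rc _].
  destruct (fubini_nonneg_le (fun k n => c n k) (S + S)
    (fun k n => proj1 (Hc n k)) HSc') as [Cc _].
  destruct (fubini_nonneg b S Hb HS) as [lb [Lb Lb']].
  destruct (fubini_nonneg c (S + S) (fun n k => proj1 (Hc n k)) HSc) as [lc [Lc Lc']].
  assert (E : forall n k, plus (c n k) (opp (b n k)) = a n k)
    by (intros; unfold plus, opp, c, b; simpl; ring).
  assert (Sr : forall n, is_series (a n) (plus (Series (c n)) (opp (Series (b n))))).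
  { intros n; apply is_series_ext with (1 := E n).
    apply (is_series_minus (V := R_NormedModule)); now apply Series_correct. }
  assert (Sc : forall k, is_series (fun n => a n k)
     (plus (Series (fun n => c n k)) (opp (Series (fun n => b n k))))).
  { intros k; apply is_series_ext with (1 := fun n => E n k).
    apply (is_series_minus (V := R_NormedModule)); apply Series_correct; auto. }
  split; [intros n; eexists; apply Sr|].
  split; [intros n; eexists; apply Sc|].
  exists (plus lc (opp lb)); split.
  - eapply is_series_ext; [intros n; symmetry; apply is_series_unique, Sr|].
    now apply (is_series_minus (V := R_NormedModule)).
  - eapply is_series_ext; [intros n; symmetry; apply is_series_unique, Sc|].
    now apply (is_series_minus (V := R_NormedModule)).
Qed.

Lemma fubini_C (a : nat -> nat -> C) (S : R) :
  (forall K L, sum_n (fun n => sum_n (fun k => Cmod (a n k)) L) K <= S)%R ->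
  exists (r c : nat -> C) (l : C),
    (forall n, is_Cseries (a n) (r n)) /\
    (forall k, is_Cseries (fun n => a n k) (c k)) /\
    is_Cseries r l /\ is_Cseries c l.
Proof.
  intros HS.
  assert (Hp : forall p : C -> R, (forall z, (Rabs (p z) <= Cmod z)%R) -> forall K L,
    (sum_n (fun n => sum_n (fun k => Rabs (p (a n k))) L) K <= S)%R).
  { intros p Hp K L; eapply Rle_trans; [|apply (HS K L)].
    apply sum_n_le_compat; intros n _; apply sum_n_le_compat; intros k _; apply Hp. }
  destruct (fubini_R _ S (Hp Re re_le_Cmod)) as [R1 [R2 [lr [R3 R4]]]].
  destruct (fubini_R _ S (Hp Im Cmod_im_le)) as [I1 [I2 [li [I3 I4]]]].
  exists (fun n => CSeries (a n)), (fun k => CSeries (fun n => a n k)), (lr, li).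
  repeat split; intros; apply is_Cseries_Re_Im; split; simpl; auto;
    apply Series_correct; auto.
Qed.

Lemma is_Cseries_Cmod_le (a : nat -> C) (l : C) (S : R) :
  (forall K, sum_n (fun n => Cmod (a n)) K <= S)%R ->
  is_Cseries a l -> (Cmod l <= S)%R.
Proof.
  intros HS Hl.
  refine (is_lim_seq_le (fun K => norm (sum_n (G := C_NormedModule) a K))
    (fun _ => S) (Finite (Cmod l)) (Finite S) _ _ (is_lim_seq_const S)).
  - intros K; eapply Rle_trans; [|apply (HS K)].
    exact (norm_sum_n_m (V := C_NormedModule) a 0 K).
  - exact (filterlim_comp _ _ _ _ _ _ _ _ Hl (filterlim_norm (V := C_NormedModule) l)).
Qed.

(** Comparison of [1 / (u + 1)^2] with the telescoping [1 / u - 1 / (u + 1)]; the subtracted term is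
    what lets the induction close. *)
Lemma sum_inv_sqr_le (K : nat) :
  (sum_n (fun n => / (INR (S n)) ^ 2) K <= 2 - / INR (S K))%R.
Proof.
  induction K as [|K IH].
  - rewrite sum_O; simpl; lra.
  - rewrite sum_Sn.
    change (sum_n (fun n => / INR (S n) ^ 2) K + / INR (S (S K)) ^ 2
            <= 2 - / INR (S (S K)))%R.
    assert (Hp : (0 < INR (S K))%R) by (apply lt_0_INR; lia).
    rewrite (S_INR (S K)).
    set (u := INR (S K)) in *.
    apply Rle_trans with ((2 - / u) + / (u + 1) ^ 2)%R; [apply Rplus_le_compat; lra|].
    assert (/ u - / (u + 1) - / (u + 1) ^ 2 = / (u * (u + 1) ^ 2))%R by (field; lra).
    assert (0 < / (u * (u + 1) ^ 2))%R; [|lra].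
    apply Rinv_0_lt_compat, Rmult_lt_0_compat; [lra|apply pow_lt; lra].
Qed.

Lemma ex_series_inv_sqr : ex_series (fun n => / (INR (S n)) ^ 2)%R.
Proof.
  apply (ex_series_bounded _ 2).
  - intros k; left; apply Rinv_0_lt_compat, pow_lt, lt_0_INR; lia.
  - intros K; eapply Rle_trans; [apply sum_inv_sqr_le|].
    assert (0 < / INR (S K))%R by (apply Rinv_0_lt_compat, lt_0_INR; lia). lra.
Qed.

(** A quadratic lower bound is all that comparison with the sum of [1 / n^2] requires. Finitely many
    [n] are absorbed into the constant. *)
Lemma Cmod_shift_ge (m : nat) (tau : C) : (2 <= m)%nat ->
  (forall n, INR (S n) ^ m <> tau) ->
  exists c, (0 < c)%R /\ forall n, (c * INR (S n) ^ 2 <= Cmod (INR (S n) ^ m - tau))%R.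
Proof.
  intros Hm Ht.
  assert (Hpos : forall n, (0 < Cmod (INR (S n) ^ m - tau))%R).
  { intros n; apply Cmod_gt_0; intros E; apply (Ht n).
    replace (INR (S n) ^ m) with (INR (S n) ^ m - tau + tau) by ring. rewrite E; ring. }
  assert (Hsmall : forall n1, exists c, (0 < c)%R /\ forall n, (n < n1)%nat ->
     (c * INR (S n) ^ 2 <= Cmod (INR (S n) ^ m - tau))%R).
  { induction n1 as [|n1 [c [Hc H]]].
    - exists 1%R; split; [lra | intros; lia].
    - assert (Hn : (0 < INR (S n1) ^ 2)%R) by (apply pow_lt, lt_0_INR; lia).
      exists (Rmin c (Cmod (INR (S n1) ^ m - tau) / INR (S n1) ^ 2)); split.
      + apply Rmin_pos; auto. apply Rdiv_lt_0_compat; auto.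
      + intros n Hlt. destruct (Nat.eq_dec n n1) as [->|Hne].
        * eapply Rle_trans; [apply Rmult_le_compat_r; [lra|apply Rmin_r]|].
          right; field; apply not_0_INR; lia.
        * eapply Rle_trans; [|apply H; lia].
          apply Rmult_le_compat_r; [apply pow2_ge_0|apply Rmin_l]. }
  (* Beyond this threshold [|tau|] is at most half of [n], hence half of [n^2], so the triangle
     inequality leaves at least [n^2 / 2]. *)
  destruct (INR_unbounded (2 * Cmod tau)) as [n1 Hn1].
  destruct (Hsmall n1) as [c [Hc H]].
  exists (Rmin c (/ 2)); split; [apply Rmin_pos; lra|].
  intros n; destruct (le_lt_dec n1 n) as [Hle|Hlt].
  - assert (H1 : (1 <= INR (S n))%R) by (apply (le_INR 1); lia).
    assert (H2 : (INR n1 <= INR (S n))%R) by (apply le_INR; lia).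
    assert (H3 : (INR (S n) ^ 2 <= INR (S n) ^ m)%R) by (apply Rle_pow; auto).
    assert (H4 : (INR (S n) ^ m <= Cmod (INR (S n) ^ m - tau) + Cmod tau)%R).
    { eapply Rle_trans; [|apply Cmod_triangle].
      replace (INR (S n) ^ m - tau + tau) with (RtoC (INR (S n) ^ m)%R)
        by (rewrite RtoC_pow; ring).
      rewrite Cmod_R; apply Rle_abs. }
    apply Rle_trans with (/ 2 * INR (S n) ^ 2)%R;
      [apply Rmult_le_compat_r; [apply pow2_ge_0|apply Rmin_r]|].
    assert (INR (S n) <= INR (S n) ^ 2)%R by nra. lra.
  - eapply Rle_trans; [|apply H; lia].
    apply Rmult_le_compat_r; [apply pow2_ge_0|apply Rmin_l].
Qed.

Lemma ex_series_inv_shift (m : nat) (tau : C) : (2 <= m)%nat ->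
  (forall n, INR (S n) ^ m <> tau) ->
  ex_series (fun n => Cmod (/ (INR (S n) ^ m - tau))).
Proof.
  intros Hm Ht.
  destruct (Cmod_shift_ge m tau Hm Ht) as [c [Hc H]].
  apply (ex_series_le (V := R_CompleteNormedModule)
    (fun n => Cmod (/ (INR (S n) ^ m - tau))) (fun n => / c * / INR (S n) ^ 2)%R).
  - intros n. unfold norm; simpl; unfold abs; simpl.
    assert (Hn : (0 < INR (S n) ^ 2)%R) by (apply pow_lt, lt_0_INR; lia).
    rewrite Rabs_pos_eq by apply Cmod_ge_0.
    assert (H0 := H n).
    assert (H1 : (0 < c * INR (S n) ^ 2)%R) by (apply Rmult_lt_0_compat; auto).
    cbv beta in H0.
    rewrite Cmod_inv.
    + rewrite <- Rinv_mult. now apply Rinv_le_contravar.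
    + apply Cmod_gt_0; eapply Rlt_le_trans; [apply H1 | apply H].
  - apply (ex_series_scal (V := R_NormedModule) (/ c)%R), ex_series_inv_sqr.
Qed.

(** * The partial fraction expansion of the cotangent *)

Lemma mvt_0 (f df : R -> R) (x : R) : f 0%R = 0%R ->
  (forall y, is_derive f y (df y)) ->
  exists c, (Rabs c <= Rabs x)%R /\ f x = (df c * x)%R.
Proof.
  intros H0 Hd.
  destruct (MVT_gen f 0 x df) as [c [Hc E]].
  - intros; apply Hd.
  - intros y _; apply continuity_pt_filterlim, (ex_derive_continuous f).
    eexists; apply Hd.
  - exists c; split; [|rewrite H0 in E; lra].
    unfold Rmin, Rmax in Hc; destruct (Rle_dec 0 x).
    + rewrite !Rabs_pos_eq; lra.
    + rewrite !Rabs_left1; lra.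
Qed.

Lemma is_derive_sinh_cosh (y : R) : is_derive sinh y (cosh y).
Proof. unfold cosh, sinh; auto_derive; auto; lra. Qed.

Lemma cosh_ge_1 (y : R) : (1 <= cosh y)%R.
Proof.
  unfold cosh. assert (H := exp_pos y).
  assert (E : (exp y * exp (- y) = 1)%R)
    by (rewrite <- exp_plus, Rplus_opp_r; apply exp_0).
  assert (H' := exp_pos (- y)).
  assert (0 <= (exp y - exp (- y)) ^ 2)%R by apply pow2_ge_0. nra.
Qed.

Lemma cosh_abs_le (x y : R) : (Rabs x <= y)%R -> (cosh x <= cosh y)%R.
Proof.
  intros H.
  assert (H1 := exp_pos x). assert (H2 := exp_pos (- x)).
  assert (E : (exp x * exp (- x) = 1)%R)
    by (rewrite <- exp_plus, Rplus_opp_r; apply exp_0).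
  assert (H3 := exp_pos y). assert (H4 := exp_pos (- y)).
  assert (E' : (exp y * exp (- y) = 1)%R)
    by (rewrite <- exp_plus, Rplus_opp_r; apply exp_0).
  assert (L : forall a b, (a <= b)%R -> (exp a <= exp b)%R).
  { intros a b [Hab|<-]; [left; now apply exp_increasing|lra]. }
  assert (L1 : (exp x <= exp y)%R) by (apply L; apply Rle_trans with (2 := H), Rle_abs).
  assert (L2 : (exp (- x) <= exp y)%R).
  { apply L; apply Rle_trans with (2 := H). rewrite <- Rabs_Ropp; apply Rle_abs. }
  unfold cosh.
  (* Since [exp x * exp (-x) = 1], this product equals [2 exp y (cosh y - cosh x)]. *)
  assert ((exp y - exp x) * (exp y - exp (- x)) >= 0)%R by nra.
  assert (exp y * (exp y + exp (- y) - exp x - exp (- x)) >= 0)%R by nra.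
  nra.
Qed.

Lemma Rabs_sin_le (x : R) : (Rabs (sin x) <= Rabs x)%R.
Proof.
  destruct (mvt_0 sin cos x sin_0) as [c [_ E]].
  - intros y; auto_derive; auto; ring.
  - rewrite E, Rabs_mult.
    assert (Rabs (cos c) <= 1)%R by (apply Rabs_le; split; apply COS_bound).
    assert (Hx := Rabs_pos x); nra.
Qed.

Lemma Rabs_sinh_le (x : R) : (Rabs (sinh x) <= Rabs x * cosh x)%R.
Proof.
  destruct (mvt_0 sinh cosh x sinh_0 is_derive_sinh_cosh) as [c [Hc E]].
  rewrite E, Rabs_mult, (Rabs_pos_eq (cosh c)) by (assert (H := cosh_ge_1 c); lra).
  rewrite Rmult_comm; apply Rmult_le_compat_l; [apply Rabs_pos|].
  assert (Ex : cosh (Rabs x) = cosh x).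
  { unfold Rabs; destruct (Rcase_abs x); auto; unfold cosh; rewrite Ropp_involutive; lra. }
  rewrite <- Ex; now apply cosh_abs_le.
Qed.

Lemma Rabs_sinh_ge (x : R) : (Rabs x <= Rabs (sinh x))%R.
Proof.
  destruct (mvt_0 sinh cosh x sinh_0 is_derive_sinh_cosh) as [c [_ E]].
  assert (H := cosh_ge_1 c).
  rewrite E, Rabs_mult, (Rabs_pos_eq (cosh c)) by lra.
  assert (H' := Rabs_pos x); nra.
Qed.

Lemma Rabs_sin_ge (x : R) : (Rabs x <= PI / 2)%R -> (Rabs x / 3 <= Rabs (sin x))%R.
Proof.
  assert (Hp : forall y, (0 <= y <= PI / 2)%R -> (y / 3 <= sin y)%R).
  { intros y Hy. assert (HPI := PI_4).
    (* The bound is [sin y >= y - y^3 / 6]; with [y <= 2] the right side is at least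
       [y - 4 y / 6 = y / 3]. *)
    destruct (sin_bound y 0) as [H _]; [lra|lra|].
    unfold sin_approx, sin_term in H; simpl in H.
    assert (y * y <= 4)%R by nra.
    assert (0 <= y * (4 - y * y))%R by (apply Rmult_le_pos; lra).
    lra. }
  intros H; unfold Rabs at 1; destruct (Rcase_abs x) as [Hx|Hx].
  - rewrite Rabs_left in H by auto.
    rewrite <- Rabs_Ropp, <- sin_neg. eapply Rle_trans; [|apply Rle_abs]. apply Hp; lra.
  - rewrite Rabs_pos_eq in H by lra. eapply Rle_trans; [|apply Rle_abs]. apply Hp; lra.
Qed.

Lemma Csin_pair (x y : R) :
  Csin (x, y) = ((sin x * cosh y)%R, (cos x * sinh y)%R).
Proof.
  unfold Csin, Cexp, Cdiv, cosh, sinh; simpl.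
  replace (0 * x - 1 * y)%R with (- y)%R by ring.
  replace (0 * y + 1 * x)%R with x by ring.
  rewrite Ropp_involutive, sin_neg, cos_neg.
  unfold Cinv, Cmult, Cminus, Cplus, Copp; simpl; f_equal; field.
Qed.

Lemma Ccos_pair (x y : R) :
  Ccos (x, y) = ((cos x * cosh y)%R, (- (sin x * sinh y))%R).
Proof.
  unfold Ccos, Cexp, Cdiv, cosh, sinh; simpl.
  replace (0 * x - 1 * y)%R with (- y)%R by ring.
  replace (0 * y + 1 * x)%R with x by ring.
  rewrite Ropp_involutive, sin_neg, cos_neg.
  unfold Cinv, Cmult, Cminus, Cplus, Copp; simpl; f_equal; field.
Qed.

Lemma Cmod_le_sum (z : C) : (Cmod z <= Rabs (Re z) + Rabs (Im z))%R.
Proof.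
  destruct z as [x y]; simpl.
  replace ((x, y) : C) with (RtoC x + Ci * RtoC y)
    by (unfold Cplus, Cmult, RtoC; simpl; f_equal; ring).
  eapply Rle_trans; [apply Cmod_triangle|].
  rewrite Cmod_mult, Cmod_Ci, !Cmod_R; lra.
Qed.

(** In this strip the only zero of the sine is the simple one at the origin. For [u = x + iy] the
    bounds [x^2 / 9] and [y^2] on the two squares give [|sin u|^2 >= |u|^2 / 18], and [6] is a
    convenient constant with [36 >= 18]. *)
Lemma Cmod_Csin_ge (u : C) : (Rabs (Re u) <= PI / 2)%R ->
  (Cmod u / 6 <= Cmod (Csin u))%R.
Proof.
  destruct u as [x y]; intros Hx; change (Re (x, y)) with x in Hx.
  assert (Hu := Cmod_le_sum (x, y)); cbn [Re Im fst snd] in Hu.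
  (* The squared modulus is [sin x ^ 2 + sinh y ^ 2]. *)
  assert (E : (Cmod (Csin (x, y)) ^ 2 = sin x ^ 2 + sinh y ^ 2)%R).
  { rewrite Cmod2_alt, Csin_pair; simpl Re; simpl Im.
    assert (H1 := sin2_cos2 x); unfold Rsqr in H1.
    assert (H2 : (cosh y * cosh y - sinh y * sinh y = 1)%R).
    { unfold cosh, sinh.
      assert (E : (exp y * exp (- y) = 1)%R)
        by (rewrite <- exp_plus, Rplus_opp_r; apply exp_0). nra. }
    replace ((sin x * cosh y) ^ 2)%R
      with (sin x ^ 2 * (1 + sinh y * sinh y))%R by (rewrite <- H2; ring).
    replace ((cos x * sinh y) ^ 2)%R
      with ((1 - sin x * sin x) * (sinh y) ^ 2)%R by (rewrite <- H1; ring).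
    ring. }
  assert (H1 := Rabs_sin_ge x Hx). assert (H2 := Rabs_sinh_ge y).
  rewrite <- (pow2_abs (sin x)), <- (pow2_abs (sinh y)) in E.
  set (A := Cmod (Csin (x, y))) in *. set (U := Cmod (x, y)) in *.
  assert (0 <= A)%R by apply Cmod_ge_0. assert (0 <= U)%R by apply Cmod_ge_0.
  assert (H3 := Rabs_pos x). assert (H4 := Rabs_pos y).
  apply Rsqr_incr_0_var; auto. unfold Rsqr.
  assert ((Rabs x / 3) ^ 2 <= Rabs (sin x) ^ 2)%R by (apply pow_incr; lra).
  assert ((Rabs y) ^ 2 <= Rabs (sinh y) ^ 2)%R by (apply pow_incr; lra).
  assert (U * U <= (Rabs x + Rabs y) * (Rabs x + Rabs y))%R
    by (apply Rmult_le_compat; auto).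
  assert (0 <= (Rabs x - Rabs y) ^ 2)%R by apply pow2_ge_0.
  nra.
Qed.

(** This is the numerator of [cot u - 1 / u], which vanishes to third order at the origin. The
    factor [4] counts four real pieces, each at most [cosh Y * |u|^3]. *)
Lemma Cmod_cos_sub_sin_le (u : C) (Y : R) : (Rabs (Im u) <= Y)%R ->
  (Cmod (u * Ccos u - Csin u) <= 4 * cosh Y * Cmod u ^ 3)%R.
Proof.
  destruct u as [x y]; change (Im (x, y)) with y; intros HY.
  set (U := Cmod (x, y)).
  assert (HU : (0 <= U)%R) by apply Cmod_ge_0.
  assert (Hx : (0 <= Rabs x <= U)%R) by (split; [apply Rabs_pos | apply (re_le_Cmod (x, y))]).
  assert (Hy : (0 <= Rabs y <= U)%R) by (split; [apply Rabs_pos | apply (Cmod_im_le (x, y))]).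
  assert (HK : (1 <= cosh Y)%R) by apply cosh_ge_1.
  assert (Hc : forall c, (Rabs c <= Rabs y)%R -> (1 <= cosh c <= cosh Y)%R).
  { intros c Hc; split; [apply cosh_ge_1 | apply cosh_abs_le; lra]. }
  assert (Hs : forall c, (Rabs c <= Rabs y)%R -> (Rabs (sinh c) <= U * cosh Y)%R).
  { intros c Hcc; eapply Rle_trans; [apply Rabs_sinh_le|].
    assert (H := Hc c Hcc). apply Rmult_le_compat; try lra. apply Rabs_pos. }
  assert (Hsx : forall c, (Rabs c <= Rabs x)%R -> (Rabs (sin c) <= U)%R).
  { intros c Hcc; eapply Rle_trans; [apply Rabs_sin_le|]; lra. }
  assert (A1 : (Rabs (x * cos x - sin x) <= U ^ 3)%R).
  { destruct (mvt_0 (fun x => x * cos x - sin x)%R (fun x => - x * sin x)%R x) as [c [Hcc E]].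
    - rewrite sin_0; ring.
    - intros z; auto_derive; auto; ring.
    - rewrite E, !Rabs_mult, Rabs_Ropp.
      replace (U ^ 3)%R with (U * U * U)%R by ring.
      assert (Hcp := Rabs_pos c).
      apply Rmult_le_compat; try lra; [apply Rmult_le_pos; auto; apply Rabs_pos|].
      apply Rmult_le_compat; try lra; [apply Rabs_pos | now apply Hsx]. }
  assert (A2 : (Rabs (y * cosh y - sinh y) <= cosh Y * U ^ 3)%R).
  { destruct (mvt_0 (fun x => x * cosh x - sinh x)%R (fun x => x * sinh x)%R y) as [c [Hcc E]].
    - rewrite sinh_0; ring.
    - intros z; unfold cosh, sinh; auto_derive; auto; field.
    - rewrite E, !Rabs_mult.
      replace (cosh Y * U ^ 3)%R with (U * (U * cosh Y) * U)%R by ring.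
      assert (Hcp := Rabs_pos c).
      apply Rmult_le_compat; try lra; [apply Rmult_le_pos; auto; apply Rabs_pos|].
      apply Rmult_le_compat; try lra; [apply Rabs_pos | now apply Hs]. }
  assert (A3 : (Rabs (sin x * sinh y) <= U * (U * cosh Y))%R).
  { rewrite Rabs_mult; apply Rmult_le_compat; try apply Rabs_pos;
      [apply Hsx; lra | apply Hs; lra]. }
  eapply Rle_trans; [apply Cmod_le_sum|].
  rewrite Ccos_pair, Csin_pair. cbn [Re Im fst snd Cmult Cminus Cplus Copp].
  (* The real and imaginary parts are regrouped so that each piece is either a one-variable
     difference of third order or a product of three small factors. *)
  replace (x * (cos x * cosh y) - y * - (sin x * sinh y) + - (sin x * cosh y))%R
    with (cosh y * (x * cos x - sin x) + y * (sin x * sinh y))%R by ring.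
  replace (x * - (sin x * sinh y) + y * (cos x * cosh y) + - (cos x * sinh y))%R
    with (cos x * (y * cosh y - sinh y) + - (x * (sin x * sinh y)))%R by ring.
  assert (B1 : (Rabs (cosh y * (x * cos x - sin x)) <= cosh Y * U ^ 3)%R).
  { rewrite Rabs_mult; destruct (Hc y) as [H1 H2]; [lra|].
    rewrite (Rabs_pos_eq (cosh y)) by lra.
    apply Rmult_le_compat; auto; try lra. apply Rabs_pos. }
  assert (B2 : (Rabs (y * (sin x * sinh y)) <= U * (U * (U * cosh Y)))%R).
  { rewrite Rabs_mult; apply Rmult_le_compat; try lra; apply Rabs_pos. }
  assert (B3 : (Rabs (cos x * (y * cosh y - sinh y)) <= 1 * (cosh Y * U ^ 3))%R).
  { rewrite Rabs_mult; apply Rmult_le_compat; auto; try apply Rabs_pos.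
    apply Rabs_le; split; apply COS_bound. }
  assert (B4 : (Rabs (- (x * (sin x * sinh y))) <= U * (U * (U * cosh Y)))%R).
  { rewrite Rabs_Ropp, Rabs_mult; apply Rmult_le_compat; try lra; apply Rabs_pos. }
  assert (T1 := Rabs_triang (cosh y * (x * cos x - sin x)) (y * (sin x * sinh y))).
  assert (T2 := Rabs_triang (cos x * (y * cosh y - sinh y)) (- (x * (sin x * sinh y)))).
  replace (4 * cosh Y * U ^ 3)%R with
    (cosh Y * U ^ 3 + U * (U * (U * cosh Y)) + (1 * (cosh Y * U ^ 3) + U * (U * (U * cosh Y))))%R
    by ring.
  lra.
Qed.

Lemma Ci2 : Ci * Ci = -1.
Proof. unfold Ci, Cmult, RtoC; simpl; f_equal; ring. Qed.

Lemma Ci_neq_0 : Ci <> 0.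
Proof. intros H; apply (f_equal snd) in H; simpl in H; lra. Qed.

Lemma C2_neq_0 : RtoC 2 <> 0.
Proof. intros H; apply RtoC_inj in H; lra. Qed.

Lemma Cmult_eq_0_l (a b : C) : b <> 0 -> a * b = 0 -> a = 0.
Proof.
  intros Hb H; replace a with (a * b / b) by (field; auto). rewrite H; field; auto.
Qed.

Lemma Cexp_double (z : C) : Cexp (2 * z) = Cexp z * Cexp z.
Proof. rewrite <- Cexp_plus; f_equal; ring. Qed.

Lemma Csin_Cexp (u : C) :
  Csin u = (Cexp (2 * Ci * u) - 1) / (2 * Ci * Cexp (Ci * u)).
Proof.
  unfold Csin. rewrite Cexp_opp.
  replace (2 * Ci * u) with (2 * (Ci * u)) by ring.
  rewrite Cexp_double. field; repeat split; auto using Cexp_neq_0, Ci_neq_0, C2_neq_0.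
Qed.

Lemma Csin_neq_0_iff (u : C) : Csin u <> 0 <-> Cexp (2 * Ci * u) - 1 <> 0.
Proof.
  assert (H := Cexp_neq_0 (Ci * u)).
  rewrite Csin_Cexp. split; intros H1 H2; apply H1.
  - rewrite H2; field; repeat split; auto using Ci_neq_0, C2_neq_0.
  - replace (Cexp (2 * Ci * u) - 1) with
      ((Cexp (2 * Ci * u) - 1) / (2 * Ci * Cexp (Ci * u)) * (2 * Ci * Cexp (Ci * u)))
      by (field; repeat split; auto using Ci_neq_0, C2_neq_0).
    rewrite H2; ring.
Qed.

Lemma Ccot_Cexp (u : C) : Csin u <> 0 ->
  Ccot u = Ci * (Cexp (2 * Ci * u) + 1) / (Cexp (2 * Ci * u) - 1).
Proof.
  intros H. assert (H1 := proj1 (Csin_neq_0_iff u) H).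
  unfold Ccot. rewrite Csin_Cexp; unfold Ccos. rewrite Cexp_opp.
  replace (2 * Ci * u) with (2 * (Ci * u)) in * by ring.
  rewrite Cexp_double in *.
  assert (H2 := Cexp_neq_0 (Ci * u)).
  field; repeat split; auto using Ci_neq_0, C2_neq_0.
Qed.

Lemma Cexp_2_Ci_PI_INR (n : nat) : Cexp (2 * Ci * (PI * INR n)) = 1.
Proof.
  replace (2 * Ci * (PI * INR n)) with (INR n * (2 * (Ci * PI))) by ring.
  rewrite <- Cexp_pow, Cexp_double, Cexp_Ci_PI.
  replace (-1 * -1) with (RtoC 1) by ring. apply Cpow_1_l.
Qed.

Definition cot_term (z : C) (n : nat) : C := 2 * z / (z ^ 2 - INR (S n) ^ 2).

Lemma nonint_add (z : C) (n : nat) : Csin (PI * z) <> 0 -> z + INR n <> 0.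
Proof.
  intros H E; apply (proj1 (Csin_neq_0_iff _) H).
  replace (2 * Ci * (PI * z))
    with (2 * Ci * PI * (z + INR n) + - (2 * Ci * (PI * INR n))) by ring.
  rewrite E, Cmult_0_r, Cplus_0_l, Cexp_opp, Cexp_2_Ci_PI_INR; field; apply C1_nz.
Qed.

Lemma nonint_sub (z : C) (n : nat) : Csin (PI * z) <> 0 -> z - INR n <> 0.
Proof.
  intros H E; apply (proj1 (Csin_neq_0_iff _) H).
  replace z with (z - INR n + INR n) by ring. rewrite E, Cplus_0_l, Cexp_2_Ci_PI_INR; ring.
Qed.

Lemma nonint_sqr (z : C) (n : nat) : Csin (PI * z) <> 0 -> z ^ 2 - INR n ^ 2 <> 0.
Proof.
  intros H E. apply (nonint_add z n H).
  apply (Cmult_eq_0_l _ (z - INR n)); [now apply nonint_sub|].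
  rewrite <- E; ring.
Qed.

Lemma nonint_neq_0 (z : C) : Csin (PI * z) <> 0 -> z <> 0.
Proof.
  intros H E; apply (nonint_add z 0 H); rewrite E; simpl; ring.
Qed.

Lemma cot_term_sum (z : C) : Csin (PI * z) <> 0 ->
  is_Cseries (cot_term z) (CSeries (cot_term z)).
Proof.
  intros H.
  assert (Hs : forall n, INR (S n) ^ 2 - z ^ 2 <> 0).
  { intros n E; apply (nonint_sqr z (S n) H).
    replace (z ^ 2 - INR (S n) ^ 2) with (- (INR (S n) ^ 2 - z ^ 2)) by ring.
    rewrite E; ring. }
  assert (E : ex_series (fun n => Cmod (/ (INR (S n) ^ 2 - z ^ 2)))).
  { apply ex_series_inv_shift; [lia|].
    intros n E; apply (Hs n); rewrite E; ring. }
  apply is_Cseries_abs in E.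
  apply (is_Cseries_scal (-2 * z)) in E.
  apply is_Cseries_ext with (b := cot_term z) in E.
  - now rewrite (CSeries_unique _ _ E).
  - intros n; unfold cot_term.
    assert (H1 := Hs n). assert (H2 := nonint_sqr z (S n) H).
    set (a := INR (S n)) in *. cbv beta. field; auto.
Qed.

(** With [p = exp(i pi z)], the two half arguments have exponentials [p] and [-p], and the full one
    has [p^2]; the duplication formula becomes a rational identity in [p]. *)
Lemma cot_half (z : C) : Csin (PI * z) <> 0 ->
  Csin (PI * (z / 2)) <> 0 /\ Csin (PI * ((z - 1) / 2)) <> 0 /\
  Ccot (PI * (z / 2)) + Ccot (PI * ((z - 1) / 2)) = 2 * Ccot (PI * z).
Proof.
  intros H. assert (H0 := proj1 (Csin_neq_0_iff _) H).
  set (p := Cexp (Ci * PI * z)).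
  assert (Hp : p <> 0) by apply Cexp_neq_0.
  assert (E0 : Cexp (2 * Ci * (PI * z)) = p * p).
  { replace (2 * Ci * (PI * z)) with (2 * (Ci * PI * z)) by ring; apply Cexp_double. }
  assert (E1 : Cexp (2 * Ci * (PI * (z / 2))) = p).
  { unfold p; f_equal; field; apply C2_neq_0. }
  assert (E2 : Cexp (2 * Ci * (PI * ((z - 1) / 2))) = - p).
  { replace (2 * Ci * (PI * ((z - 1) / 2))) with (Ci * PI * z + - (Ci * PI))
      by (field; apply C2_neq_0).
    rewrite Cexp_plus, Cexp_opp, Cexp_Ci_PI; fold p; field. }
  rewrite E0 in H0.
  assert (H1 : p - 1 <> 0).
  { intros E; apply H0. replace (p * p - 1) with ((p - 1) * (p + 1)) by ring.
    rewrite E; ring. }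
  assert (H2 : - p - 1 <> 0).
  { intros E; apply H0. replace (p * p - 1) with ((- p - 1) * (1 - p)) by ring.
    rewrite E; ring. }
  assert (S1 : Csin (PI * (z / 2)) <> 0) by (apply Csin_neq_0_iff; now rewrite E1).
  assert (S2 : Csin (PI * ((z - 1) / 2)) <> 0) by (apply Csin_neq_0_iff; now rewrite E2).
  repeat split; auto.
  rewrite !Ccot_Cexp, E0, E1, E2; auto. field; auto.
Qed.

(** The [z / 2] term has the poles [2n + 2] and [-(2n + 2)], but the [(z - 1) / 2] term has [2n + 3]
    and [-(2n + 1)] where the pairing needs [2n + 1] and [-(2n + 1)]. Moving that one pole costs the
    last, telescoping difference. *)
Lemma cot_term_pair (z : C) (n : nat) : Csin (PI * z) <> 0 ->
  cot_term (z / 2) n + cot_term ((z - 1) / 2) n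
  = 2 * (cot_term z (2 * n) + cot_term z (2 * n + 1))
    + 2 * (/ (z - INR (2 * n + 3)) - / (z - INR (2 * n + 1))).
Proof.
  intros H. unfold cot_term.
  destruct (cot_half z H) as [Ha [Hb _]].
  assert (H1 := nonint_sqr _ (S n) Ha). assert (H2 := nonint_sqr _ (S n) Hb).
  assert (H3 := nonint_sqr z (2 * n + 1) H). assert (H4 := nonint_sqr z (2 * n + 2) H).
  assert (H5 := nonint_sub z (2 * n + 1) H). assert (H6 := nonint_sub z (2 * n + 3) H).
  assert (H8 := nonint_add z (2 * n + 1) H).
  replace (S (2 * n)) with (2 * n + 1)%nat by lia.
  replace (S (2 * n + 1)) with (2 * n + 2)%nat by lia.
  assert (E1 : INR (S n) = INR n + 1 :> C) by (rewrite S_INR, RtoC_plus; reflexivity).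
  assert (E2 : forall k, INR (2 * n + k) = 2 * INR n + INR k :> C).
  { intros k; rewrite plus_INR, mult_INR, !RtoC_plus, RtoC_mult; simpl INR.
    f_equal; f_equal; f_equal; ring. }
  rewrite !E2 in *. rewrite E1 in *.
  replace (RtoC (INR 1)) with (RtoC 1) in * by reflexivity.
  replace (RtoC (INR 2)) with (RtoC 2) in * by (f_equal; simpl; ring).
  replace (RtoC (INR 3)) with (RtoC 3) in * by (f_equal; simpl; ring).
  set (a := RtoC (INR n)) in *.
  assert (E4 : z ^ 2 - (2 * a + 2) ^ 2 = 4 * ((z / 2) ^ 2 - (a + 1) ^ 2)).
  { field; apply C2_neq_0. }
  assert (E5 : (z - 1) ^ 2 - (2 * a + 2) ^ 2 = 4 * (((z - 1) / 2) ^ 2 - (a + 1) ^ 2)).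
  { field; apply C2_neq_0. }
  assert (H4' := H4). rewrite E4 in H4'.
  assert (H7 : RtoC 4 <> 0) by (intros E; apply RtoC_inj in E; lra).
  assert (H9 : (z - 1) ^ 2 - (2 * a + 2) ^ 2 <> 0).
  { rewrite E5. intros E; apply H2; apply (Cmult_eq_0_l _ 4); auto.
    rewrite <- E; ring. }
  replace ((z / 2) ^ 2 - (a + 1) ^ 2) with ((z ^ 2 - (2 * a + 2) ^ 2) / 4)
    by (rewrite E4; field; auto).
  replace (((z - 1) / 2) ^ 2 - (a + 1) ^ 2) with (((z - 1) ^ 2 - (2 * a + 2) ^ 2) / 4)
    by (rewrite E5; field; auto).
  assert (E6 : 2 * (z / 2) / ((z ^ 2 - (2 * a + 2) ^ 2) / 4)
               = 2 * (2 * z / (z ^ 2 - (2 * a + 2) ^ 2))).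
  { field; repeat split; auto using C2_neq_0. }
  rewrite E6.
  assert (E7 : (z - 1) ^ 2 - (2 * a + 2) ^ 2 = (z - (2 * a + 3)) * (z + (2 * a + 1)))
    by ring.
  assert (E8 : z ^ 2 - (2 * a + 1) ^ 2 = (z - (2 * a + 1)) * (z + (2 * a + 1))) by ring.
  rewrite E7, E8 in *.
  field; repeat split; auto using C2_neq_0.
Qed.

Lemma is_Cseries_sub_pairs (a : nat -> C) (l : C) :
  is_Cseries a l -> is_Cseries (fun n => a (2 * n)%nat + a (2 * n + 1)%nat) l.
Proof.
  intros H. unfold is_series in *.
  apply filterlim_ext with (fun n => sum_n (G := C_NormedModule) a (2 * n + 1)).
  - induction x as [|n IH].
    + simpl Nat.add; rewrite sum_Sn, !sum_O; reflexivity.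
    + rewrite sum_Sn, <- IH.
      replace (2 * S n + 1)%nat with (S (S (2 * n + 1))) by lia.
      rewrite !sum_Sn, <- plus_assoc. f_equal.
      replace (S (2 * n + 1)) with (2 * S n)%nat by lia.
      replace (S (2 * S n)) with (2 * S n + 1)%nat by lia. reflexivity.
  - apply (filterlim_comp _ _ _ (fun n => (2 * n + 1)%nat) (sum_n a) eventually eventually);
      [|exact H].
    intros P [N HN]; exists N; intros n Hn; apply HN; lia.
Qed.

Lemma is_Cseries_telescope (u : nat -> C) :
  (forall eps : posreal, eventually (fun n => Cmod (u n) < eps)%R) ->
  is_Cseries (fun n => u (S n) - u n) (- u 0%nat).
Proof.
  intros H P [eps HP].
  destruct (H eps) as [N HN]. exists N; intros n Hn. apply HP.
  assert (E : sum_n (G := C_NormedModule) (fun n => u (S n) - u n) n = u (S n) - u 0%nat).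
  { clear; induction n as [|n IH]; [now rewrite sum_O|].
    rewrite sum_Sn, IH; unfold plus; simpl; ring. }
  rewrite E. apply (norm_compat1 (V := C_NormedModule)).
  change (Cmod (u (S n) - u 0%nat - - u 0%nat) < eps)%R.
  replace (u (S n) - u 0%nat - - u 0%nat) with (u (S n)) by ring.
  apply HN; lia.
Qed.

Lemma cot_term_double (z : C) : Csin (PI * z) <> 0 ->
  CSeries (cot_term (z / 2)) + CSeries (cot_term ((z - 1) / 2))
  = 2 * CSeries (cot_term z) - 2 / (z - 1).
Proof.
  intros H. destruct (cot_half z H) as [Ha [Hb _]].
  apply (is_Cseries_unique (fun n => cot_term (z / 2) n + cot_term ((z - 1) / 2) n)).
  - apply is_Cseries_plus; now apply cot_term_sum.
  (* The telescoping corrections add up to [- u 0 = -1 / (z - 1)], which explains the extra term of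
     the statement. *)
  - set (u := fun n => / (z - INR (2 * n + 1))).
    assert (Ht : is_Cseries (fun n => u (S n) - u n) (- u 0%nat)).
    { apply is_Cseries_telescope. intros eps.
      destruct (INR_unbounded (Cmod z + / eps)) as [N HN].
      exists N; intros n Hn. unfold u.
      rewrite Cmod_inv by (now apply nonint_sub).
      assert (He := cond_pos eps).
      rewrite <- (Rinv_inv eps). apply Rinv_lt_contravar.
      - apply Rmult_lt_0_compat; [now apply Rinv_0_lt_compat|].
        apply Cmod_gt_0; now apply nonint_sub.
      - assert (H1 : (INR N <= INR (2 * n + 1))%R) by (apply le_INR; lia).
        assert (H2 := Cmod_triangle (z - INR (2 * n + 1)) (- z)).
        rewrite Cmod_opp in H2.
        replace (z - INR (2 * n + 1) + - z) with (- INR (2 * n + 1)) in H2 by ring.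
        rewrite Cmod_opp, Cmod_R, Rabs_pos_eq in H2 by apply pos_INR. lra. }
    assert (Hp := is_Cseries_scal 2 _ _
      (is_Cseries_sub_pairs _ _ (cot_term_sum z H))).
    apply (is_Cseries_scal 2) in Ht.
    assert (Hs := is_Cseries_plus _ _ _ _ Hp Ht).
    replace (2 * CSeries (cot_term z) - 2 / (z - 1))
      with (2 * CSeries (cot_term z) + 2 * - u 0%nat).
    + eapply is_Cseries_ext; [|exact Hs].
      intros n; cbv beta; rewrite cot_term_pair by auto. unfold u.
      replace (2 * S n + 1)%nat with (2 * n + 3)%nat by lia. reflexivity.
    + unfold u; simpl Nat.add; simpl INR.
      assert (H1 := nonint_sub z 1 H); simpl INR in H1. field; auto.
Qed.

Definition cot_defect (z : C) : C :=
  PI * Ccot (PI * z) - / z - CSeries (cot_term z).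

(** The halved arguments contribute [2 / z + 2 / (z - 1)] through the term [/ z], and [2 / (z - 1)]
    cancels against the telescoping remainder of the series. *)
Lemma cot_defect_double (z : C) : Csin (PI * z) <> 0 ->
  2 * cot_defect z = cot_defect (z / 2) + cot_defect ((z - 1) / 2).
Proof.
  intros H. unfold cot_defect.
  destruct (cot_half z H) as [Ha [Hb E]].
  assert (H0 := nonint_neq_0 z H).
  assert (H1 := nonint_sub z 1 H); simpl INR in H1.
  assert (D := cot_term_double z H).
  replace (2 * (PI * Ccot (PI * z) - / z - CSeries (cot_term z)))
    with (PI * (2 * Ccot (PI * z)) - 2 / z - 2 / (z - 1)
          - (2 * CSeries (cot_term z) - 2 / (z - 1))) by (field; auto).
  rewrite <- E, <- D. field; repeat split; auto using C2_neq_0.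
Qed.

Lemma Csin_opp (u : C) : Csin (- u) = - Csin u.
Proof.
  unfold Csin. replace (Ci * - u) with (- (Ci * u)) by ring.
  replace (- - (Ci * u)) with (Ci * u) by ring; field; auto using Ci_neq_0.
Qed.

Lemma Ccot_opp (u : C) : Csin u <> 0 -> Ccot (- u) = - Ccot u.
Proof.
  intros H. unfold Ccot. rewrite Csin_opp. unfold Ccos.
  replace (Ci * - u) with (- (Ci * u)) by ring.
  replace (- - (Ci * u)) with (Ci * u) by ring; field.
  repeat split; auto using C2_neq_0. 
Qed.

Lemma nonint_opp (z : C) : Csin (PI * z) <> 0 -> Csin (PI * - z) <> 0.
Proof.
  intros H E; apply H. replace (PI * z) with (- (PI * - z)) by ring.
  rewrite Csin_opp, E; ring.
Qed.

Lemma cot_defect_opp (z : C) : Csin (PI * z) <> 0 -> cot_defect (- z) = - cot_defect z.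
Proof.
  intros H. unfold cot_defect.
  replace (CSeries (cot_term (- z))) with (- 1 * CSeries (cot_term z)).
  - replace (PI * - z) with (- (PI * z)) by ring.
    rewrite Ccot_opp by auto. assert (H0 := nonint_neq_0 z H). field; auto.
  - symmetry; apply CSeries_unique.
    eapply is_Cseries_ext; [|apply is_Cseries_scal, (cot_term_sum z H)].
    intros n; unfold cot_term; cbv beta. assert (H1 := nonint_sqr z (S n) H).
    replace ((- z) ^ 2) with (z ^ 2) by ring. field; auto.
Qed.

Lemma Re_scal (x : R) (z : C) : Re (x * z) = (x * Re z)%R.
Proof. unfold Re; simpl; ring. Qed.

Lemma Im_scal (x : R) (z : C) : Im (x * z) = (x * Im z)%R.
Proof. unfold Im; simpl; ring. Qed.

Lemma Cdiv_2 (z : C) : z / 2 = RtoC (/ 2) * z.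
Proof.
  unfold Cdiv, Cinv, Cmult, RtoC; destruct z; simpl; f_equal; field.
Qed.

Lemma Re_half (z : C) : Re (z / 2) = (Re z / 2)%R.
Proof. rewrite Cdiv_2, Re_scal; lra. Qed.

Lemma Im_half (z : C) : Im (z / 2) = (Im z / 2)%R.
Proof. rewrite Cdiv_2, Im_scal; lra. Qed.

(** Here [24 = 4 * 6] combines the bounds on [u cos u - sin u] and on [sin u]. For the series,
    [|z - n|] and [|z + n|] are at least [n / 2], so each term is at most [8 |z| / n^2], and the sum
    of [1 / n^2] is at most [2], whence [16]. *)
Lemma cot_defect_small (Y : R) : exists L, (0 <= L)%R /\
  forall z, (Rabs (Re z) <= / 2)%R -> (Rabs (Im z) <= Y)%R -> Csin (PI * z) <> 0 ->
    (Cmod (cot_defect z) <= L * Cmod z)%R.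
Proof.
  assert (HPI := PI_RGT_0).
  exists (24 * cosh (PI * Y) * PI ^ 2 + 16)%R.
  assert (HK := cosh_ge_1 (PI * Y)).
  assert (HP2 : (0 <= PI ^ 2)%R) by apply pow2_ge_0.
  split; [assert (0 <= cosh (PI * Y) * PI ^ 2)%R by (apply Rmult_le_pos; lra); lra|].
  intros z Hr Hi Hz. unfold cot_defect.
  assert (Hz0 := nonint_neq_0 z Hz).
  assert (Hzp : (0 < Cmod z)%R) by now apply Cmod_gt_0.
  assert (Hup : RtoC PI <> 0) by (intros E; apply RtoC_inj in E; lra).
  set (u := PI * z).
  assert (Hu : Cmod u = (PI * Cmod z)%R).
  { unfold u; rewrite Cmod_mult, Cmod_R, Rabs_pos_eq; lra. }
  assert (B1 : (Cmod (PI * Ccot u - / z) <= 24 * cosh (PI * Y) * PI ^ 2 * Cmod z)%R).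
  { replace (PI * Ccot u - / z) with ((u * Ccos u - Csin u) / (z * Csin u))
      by (unfold Ccot, u; field; auto).
    rewrite Cmod_div, Cmod_mult by (now apply Cmult_neq_0).
    assert (N1 := Cmod_cos_sub_sin_le u (PI * Y)).
    assert (N2 := Cmod_Csin_ge u). rewrite Hu in N1, N2.
    assert (N1' : (Cmod (u * Ccos u - Csin u) <= 4 * cosh (PI * Y) * (PI * Cmod z) ^ 3)%R).
    { apply N1. unfold u; rewrite Im_scal, Rabs_mult, (Rabs_pos_eq PI) by lra.
      apply Rmult_le_compat_l; lra. }
    assert (N2' : (PI * Cmod z / 6 <= Cmod (Csin u))%R).
    { apply N2. unfold u; rewrite Re_scal, Rabs_mult, (Rabs_pos_eq PI) by lra.
      unfold Rdiv; apply Rmult_le_compat_l; lra. }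
    assert (Hq : (0 < PI * Cmod z / 6)%R).
    { apply Rdiv_lt_0_compat; [apply Rmult_lt_0_compat; auto | lra]. }
    apply Rle_div_l; [apply Rmult_lt_0_compat; lra|].
    eapply Rle_trans; [exact N1'|].
    apply Rle_trans with
      (24 * cosh (PI * Y) * PI ^ 2 * Cmod z * (Cmod z * (PI * Cmod z / 6)))%R.
    - right; field.
    - apply Rmult_le_compat_l.
      + apply Rmult_le_pos; [|lra]. apply Rmult_le_pos; lra.
      + apply Rmult_le_compat_l; lra. }
  assert (B2 : (Cmod (CSeries (cot_term z)) <= 16 * Cmod z)%R).
  { apply (is_Cseries_Cmod_le (cot_term z)); [|now apply cot_term_sum].
    intros K. apply Rle_trans with
      (sum_n (fun n => scal (8 * Cmod z)%R (/ INR (S n) ^ 2)%R) K).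
    - apply sum_n_le_compat; intros n _. unfold cot_term.
      assert (Hn1 : (1 <= INR (S n))%R) by (apply (le_INR 1); lia).
      assert (F : forall w : C, (Rabs (Re w) <= / 2)%R ->
        (INR (S n) / 2 <= Cmod (w - INR (S n)))%R).
      { intros w Hw. eapply Rle_trans; [|apply re_le_Cmod].
        change (Re (w - INR (S n))) with (Re w - INR (S n))%R.
        rewrite <- Rabs_Ropp. eapply Rle_trans; [|apply Rle_abs].
        assert (H0 := Rle_abs (Re w)). lra. }
      assert (F1 := F z Hr). assert (F2 : (INR (S n) / 2 <= Cmod (z + INR (S n)))%R).
      { rewrite <- Cmod_opp. replace (- (z + INR (S n))) with (- z - INR (S n)) by ring.
        apply F. simpl Re; now rewrite Rabs_Ropp. }
      assert (Hd := nonint_sqr z (S n) Hz).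
      rewrite Cmod_div, Cmod_mult, Cmod_R, Rabs_pos_eq by (auto; lra).
      replace (z ^ 2 - INR (S n) ^ 2) with ((z - INR (S n)) * (z + INR (S n))) by ring.
      rewrite Cmod_mult. change (scal (8 * Cmod z)%R (/ INR (S n) ^ 2)%R)
        with (8 * Cmod z * / INR (S n) ^ 2)%R.
      assert (Hq : (0 < INR (S n) / 2)%R) by lra.
      assert (Hm : (INR (S n) / 2 * (INR (S n) / 2)
                    <= Cmod (z - INR (S n)) * Cmod (z + INR (S n)))%R)
        by (apply Rmult_le_compat; lra).
      apply Rle_trans with (2 * Cmod z / (INR (S n) / 2 * (INR (S n) / 2)))%R.
      + apply Rmult_le_compat_l; [lra|]. apply Rinv_le_contravar; [|exact Hm].
        apply Rmult_lt_0_compat; auto.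
      + right. set (b := INR (S n)) in *. clearbody b.
        field; lra.
    - rewrite sum_n_scal_l. 
      change (8 * Cmod z * sum_n (fun n => (/ INR (S n) ^ 2)%R) K <= 16 * Cmod z)%R.
      assert (HS := sum_inv_sqr_le K).
      assert (0 < / INR (S K))%R by (apply Rinv_0_lt_compat, lt_0_INR; lia).
      replace (16 * Cmod z)%R with (8 * Cmod z * 2)%R by ring.
      apply Rmult_le_compat_l; lra. }
  unfold Cminus at 1. eapply Rle_trans; [apply Cmod_triangle|].
  rewrite Cmod_opp. lra.
Qed.

(* Herglotz' trick: a bounded solution of [2 f(z) = f(z/2) + f((z-1)/2)] which is
   [O(z)] at the origin vanishes, since [z/2 ^ j] tends to the origin. *)
Lemma cot_defect_strip (z : C) : (Rabs (Re z) <= / 2)%R -> Csin (PI * z) <> 0 ->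
  cot_defect z = 0.
Proof.
  intros Hr Hz. set (Y := Rabs (Im z)).
  (* A domain stable under [w / 2], under [- w], and under [(w - 1) / 2] when [Re w >= 0]. The last
     restriction is why oddness of the defect is needed below. *)
  set (D := fun w : C => (Rabs (Re w) <= / 2)%R /\ (Rabs (Im w) <= Y)%R
                         /\ Csin (PI * w) <> 0).
  assert (HzD : D z) by (repeat split; auto; unfold Y; lra).
  destruct (cot_defect_small Y) as [L [HL0 HL]].
  assert (HY : (0 <= Y)%R) by apply Rabs_pos.
  assert (HD : forall w, D w -> (Cmod w <= 1 + Y)%R).
  { intros w [H1 [H2 _]]. assert (H := Cmod_le_sum w). lra. }
  (* [S] is the supremum of the defect on [D]; the aim is [S <= 0]. *)
  destruct (completeness (fun r => exists w, D w /\ r = Cmod (cot_defect w)))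
    as [S [HS1 HS2]].
  { exists (L * (1 + Y))%R. intros r [w [Hw ->]].
    destruct Hw as [H1 [H2 H3]].
    eapply Rle_trans; [now apply HL|].
    apply Rmult_le_compat_l; auto. now apply HD. }
  { exists (Cmod (cot_defect z)), z; auto. }
  assert (HS : forall w, D w -> (Cmod (cot_defect w) <= S)%R).
  { intros w Hw; apply HS1; now exists w. }
  assert (Hhalf : forall w, Cmod (w / 2) = (Cmod w / 2)%R).
  { intros w; rewrite Cmod_div by apply C2_neq_0. rewrite Cmod_R, Rabs_pos_eq; lra. }
  assert (HDopp : forall w, D w -> D (- w)).
  { intros w [H1 [H2 H3]]; repeat split.
    - simpl; now rewrite Rabs_Ropp.
    - simpl; now rewrite Rabs_Ropp.
    - now apply nonint_opp. }
  assert (HDhalf : forall w, D w -> D (w / 2)).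
  { intros w [H1 [H2 H3]]; repeat split.
    - rewrite Re_half; unfold Rdiv; rewrite Rabs_mult, (Rabs_pos_eq (/ 2)) by lra.
      assert (H := Rabs_pos (Re w)); lra.
    - rewrite Im_half; unfold Rdiv; rewrite Rabs_mult, (Rabs_pos_eq (/ 2)) by lra.
      assert (H := Rabs_pos (Im w)); lra.
    - exact (proj1 (cot_half w H3)). }
  assert (Hstep0 : forall w, D w -> (0 <= Re w)%R ->
    (Cmod (cot_defect w) <= / 2 * Cmod (cot_defect (w / 2)) + / 2 * S)%R).
  { intros w Hw Hp. assert (Hw' := Hw). destruct Hw' as [H1 [H2 H3]].
    assert (E := cot_defect_double w H3).
    apply (f_equal Cmod) in E. rewrite Cmod_mult, Cmod_R, Rabs_pos_eq in E by lra.
    assert (T := Cmod_triangle (cot_defect (w / 2)) (cot_defect ((w - 1) / 2))).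
    assert (Hd : D ((w - 1) / 2)).
    { repeat split.
      - rewrite Re_half. simpl Re. rewrite Rabs_pos_eq in H1 by auto.
        unfold Re in *. apply Rabs_le; lra.
      - rewrite Im_half. simpl Im. replace (Im w + - 0)%R with (Im w) by ring.
        replace (snd w + - 0)%R with (Im w) by (unfold Im; ring).
        unfold Rdiv; rewrite Rabs_mult, (Rabs_pos_eq (/ 2)) by lra.
        assert (H := Rabs_pos (Im w)); lra.
      - exact (proj1 (proj2 (cot_half w H3))). }
    assert (B := HS _ Hd). lra. }
  assert (Hstep : forall w, D w ->
    (Cmod (cot_defect w) <= / 2 * Cmod (cot_defect (w / 2)) + / 2 * S)%R).
  { intros w Hw. destruct (Rle_lt_dec 0 (Re w)) as [Hp|Hn]; [now apply Hstep0|].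
    assert (H := Hstep0 (- w) (HDopp w Hw)).
    replace (- w / 2) with (- (w / 2)) in H by (field; apply C2_neq_0).
    rewrite !cot_defect_opp, !Cmod_opp in H; try apply Hw; try (apply (HDhalf w Hw)).
    apply H. simpl; unfold Re in Hn; lra. }
  (* After [j] halvings the surviving term has weight [2^-j] from the functional equation and
     another [2^-j] from the linear bound at [w / 2^j]; the discarded terms, each at most [S], have
     total weight [1 - 2^-j]. *)
  assert (Hit : forall j w, D w -> (Cmod (cot_defect w)
     <= L * Cmod w * ((/ 2) ^ j * (/ 2) ^ j) + (1 - (/ 2) ^ j) * S)%R).
  { induction j as [|j IH]; intros w Hw.
    - simpl. destruct Hw as [H1 [H2 H3]]. assert (H := HL w H1 H2 H3). lra.
    - assert (H := Hstep w Hw). assert (H' := IH _ (HDhalf w Hw)).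
      rewrite Hhalf in H'. simpl pow. set (q := ((/ 2) ^ j)%R) in *.
      replace (L * Cmod w * (/ 2 * q * (/ 2 * q)) + (1 - / 2 * q) * S)%R
        with (/ 2 * (L * (Cmod w / 2) * (q * q) + (1 - q) * S) + / 2 * S)%R by field.
      lra. }
  (* Taking the supremum, [2^-j S] remains on the left, and dividing by [2^-j] still leaves one such
     factor on the right. *)
  assert (HSj : forall j, (S <= L * (1 + Y) * (/ 2) ^ j)%R).
  { intros j. assert (Hq : (0 < (/ 2) ^ j)%R) by (apply pow_lt; lra).
    set (q := ((/ 2) ^ j)%R) in *.
    assert (H : (S <= L * (1 + Y) * (q * q) + (1 - q) * S)%R).
    { apply HS2. intros r [w [Hw ->]].
      eapply Rle_trans; [apply (Hit j w Hw)|]. fold q. apply Rplus_le_compat_r.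
      apply Rmult_le_compat_r; [nra|]. apply Rmult_le_compat_l; auto. }
    apply Rmult_le_reg_r with q; auto. nra. }
  assert (HS0 : (S <= 0)%R).
  { refine (is_lim_seq_le (fun _ => S) (fun j => L * (1 + Y) * (/ 2) ^ j)%R
      (Finite S) (Finite 0) HSj (is_lim_seq_const S) _).
    replace (Finite 0) with (Rbar_mult (Finite (L * (1 + Y))) (Finite 0))
      by (simpl; f_equal; ring).
    apply is_lim_seq_scal_l. apply is_lim_seq_geom. rewrite Rabs_pos_eq; lra. }
  apply Cmod_eq_0. assert (H := HS z HzD). assert (H' := Cmod_ge_0 (cot_defect z)). lra.
Qed.

(** The functional equation doubles the width of the strip where the defect is known to vanish;
    oddness again reduces to [Re w >= 0]. *)
Lemma cot_defect_eq_0 (z : C) : Csin (PI * z) <> 0 -> cot_defect z = 0.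
Proof.
  assert (H : forall j w, (Rabs (Re w) <= / 2 * 2 ^ j)%R -> Csin (PI * w) <> 0 ->
    cot_defect w = 0).
  { induction j as [|j IH]; intros w Hw Hs.
    - apply cot_defect_strip; auto. simpl in Hw; lra.
    - assert (Hpow : (1 <= 2 ^ j)%R) by (apply pow_R1_Rle; lra).
      simpl pow in Hw.
      assert (Hpos : forall w, (0 <= Re w)%R -> (Rabs (Re w) <= / 2 * (2 * 2 ^ j))%R ->
        Csin (PI * w) <> 0 -> cot_defect w = 0).
      { clear w Hw Hs; intros w Hp Hw Hs.
        rewrite Rabs_pos_eq in Hw by auto.
        destruct (cot_half w Hs) as [Ha [Hb _]].
        assert (E := cot_defect_double w Hs).
        rewrite (IH (w / 2)), (IH ((w - 1) / 2)) in E; auto.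
        - apply (Cmult_eq_0_l _ 2); [apply C2_neq_0|]. rewrite Cmult_comm, E; ring.
        - rewrite Re_half; simpl Re; unfold Re in *; apply Rabs_le; lra.
        - rewrite Re_half; unfold Re in *; apply Rabs_le; lra. }
      destruct (Rle_lt_dec 0 (Re w)) as [Hp|Hn]; [now apply Hpos|].
      replace w with (- - w) by ring.
      rewrite cot_defect_opp by now apply nonint_opp.
      rewrite Hpos; [ring | simpl; unfold Re in Hn; lra | simpl; now rewrite Rabs_Ropp |
        now apply nonint_opp]. }
  intros Hz.
  destruct (Pow_x_infinity 2) with (b := (2 * Rabs (Re z))%R) as [j Hj];
    [rewrite Rabs_pos_eq; lra|].
  apply (H j); auto. specialize (Hj j (Nat.le_refl _)).
  rewrite (Rabs_pos_eq (2 ^ j)) in Hj by (apply pow_le; lra). lra.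
Qed.

Theorem cot_expansion (z : C) : Csin (PI * z) <> 0 ->
  is_Cseries (cot_term z) (PI * Ccot (PI * z) - / z).
Proof.
  intros H. assert (E := cot_defect_eq_0 z H). unfold cot_defect in E.
  replace (PI * Ccot (PI * z) - / z) with (CSeries (cot_term z)); [now apply cot_term_sum|].
  replace (PI * Ccot (PI * z) - / z)
    with (PI * Ccot (PI * z) - / z - CSeries (cot_term z) + CSeries (cot_term z)) by ring.
  rewrite E; ring.
Qed.

Lemma Csum_lt_swap (m n : nat) (f : nat -> nat -> C) :
  Csum_lt m (fun r => Csum_lt n (f r)) = Csum_lt n (fun j => Csum_lt m (fun r => f r j)).
Proof.
  induction m as [|m IH]; simpl.
  - rewrite Csum_lt_const; ring.
  - now rewrite IH, Csum_lt_plus.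
Qed.

Lemma Csum_lt_geom (m : nat) (c : C) : (1 - c) * Csum_lt m (fun r => c ^ r) = 1 - c ^ m.
Proof.
  induction m as [|m IH]; simpl; [ring|].
  rewrite Cmult_plus_distr_l, IH; ring.
Qed.

Lemma Csum_lt_sub_pow (m : nat) (a c : C) :
  (a - c) * Csum_lt m (fun j => c ^ j * a ^ (m - 1 - j)) = a ^ m - c ^ m.
Proof.
  induction m as [|m IH]; simpl; [ring|].
  rewrite !Nat.sub_0_r, Nat.sub_diag.
  rewrite (Csum_lt_ext m _ (fun j => a * (c ^ j * a ^ (m - 1 - j)))).
  - rewrite Csum_lt_scal.
    replace ((a - c) * (a * Csum_lt m (fun j => c ^ j * a ^ (m - 1 - j)) + c ^ m * a ^ 0))
      with (a * ((a - c) * Csum_lt m (fun j => c ^ j * a ^ (m - 1 - j))) + (a - c) * c ^ m)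
      by (simpl; ring).
    rewrite IH; ring.
  - intros r Hr. replace (m - r)%nat with (S (m - 1 - r)) by lia. simpl; ring.
Qed.

(** * Sums over roots of unity *)

Lemma Cexp_Ci_neq_1 (th : R) : (0 < th < 2 * PI)%R -> Cexp (Ci * th) <> 1.
Proof.
  intros H E. apply (f_equal fst) in E; simpl in E.
  replace (0 * th - 1 * 0)%R with 0%R in E by ring.
  replace (0 * 0 + 1 * th)%R with (2 * (th / 2))%R in E by field.
  rewrite exp_0, cos_2a_sin in E.
  assert (Hs : (0 < sin (th / 2))%R) by (apply sin_gt_0; lra).
  nra.
Qed.

(* The powers of [exp (i pi / m)], a primitive root of unity of order [2 m]. *)
Definition half_root (m r : nat) : C := Cexp (Ci * INR r * PI / INR m).

Lemma half_root_pow (m r : nat) : (1 <= m)%nat ->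
  half_root m r = Cexp (Ci * PI / INR m) ^ r.
Proof.
  intros Hm; unfold half_root. rewrite Cexp_pow; f_equal.
  field; now apply INR_pos_neq_0.
Qed.

Lemma Cexp_Ci_PI_div_pow (m : nat) : (1 <= m)%nat -> Cexp (Ci * PI / INR m) ^ m = -1.
Proof.
  intros Hm. rewrite Cexp_pow, <- Cexp_Ci_PI; f_equal.
  field; now apply INR_pos_neq_0.
Qed.

Lemma Cexp_Ci_PI_div_neq_1 (m : nat) : (1 <= m)%nat -> 1 - Cexp (Ci * PI / INR m) <> 0.
Proof.
  intros Hm E. assert (H := Cexp_Ci_PI_div_pow m Hm).
  replace (Cexp (Ci * PI / INR m)) with (RtoC 1) in H.
  - rewrite Cpow_1_l in H; apply RtoC_inj in H; lra.
  - replace (Cexp (Ci * PI / INR m)) with (1 - (1 - Cexp (Ci * PI / INR m))) by ring.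
    rewrite E; ring.
Qed.

Lemma half_root_sum (m : nat) : (1 <= m)%nat ->
  Csum_lt m (half_root m) = 2 / (1 - Cexp (Ci * PI / INR m)).
Proof.
  intros Hm. assert (H := Cexp_Ci_PI_div_neq_1 m Hm).
  rewrite (Csum_lt_ext m _ (fun r => Cexp (Ci * PI / INR m) ^ r))
    by (intros; now apply half_root_pow).
  assert (G := Csum_lt_geom m (Cexp (Ci * PI / INR m))).
  rewrite Cexp_Ci_PI_div_pow in G by auto.
  replace (1 - -1) with (RtoC 2) in G by ring.
  rewrite <- G; field; auto.
Qed.

Definition unit_root (m : nat) : C := Cexp (2 * Ci * PI / INR m).

Lemma half_root_sqr (m r : nat) : (1 <= m)%nat -> half_root m r ^ 2 = unit_root m ^ r.
Proof.
  intros Hm; unfold half_root, unit_root. rewrite !Cexp_pow; f_equal.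
  simpl INR; rewrite RtoC_plus; field; now apply INR_pos_neq_0.
Qed.

Lemma unit_root_pow_order (m : nat) : (1 <= m)%nat -> unit_root m ^ m = 1.
Proof.
  intros Hm; unfold unit_root. rewrite Cexp_pow, <- (Cexp_2_Ci_PI_INR 1); f_equal.
  simpl INR; field; now apply INR_pos_neq_0.
Qed.

Lemma unit_root_pow_neq_1 (m k : nat) : (0 < k < m)%nat -> unit_root m ^ k <> 1.
Proof.
  intros H; unfold unit_root. rewrite Cexp_pow.
  assert (Hk : (0 < INR k)%R) by (apply lt_0_INR; lia).
  assert (Hm : (0 < INR m)%R) by (apply lt_0_INR; lia).
  assert (Hkm : (INR k < INR m)%R) by (apply lt_INR; lia).
  replace (INR k * (2 * Ci * PI / INR m)) with (Ci * (2 * PI * (INR k / INR m))%R).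
  - assert (HPI := PI_RGT_0).
    apply Cexp_Ci_neq_1; split.
    + apply Rmult_lt_0_compat; [lra | now apply Rdiv_lt_0_compat].
    + assert (INR k / INR m < 1)%R by (apply Rlt_div_l; lra).
      rewrite <- (Rmult_1_r (2 * PI)) at 2. apply Rmult_lt_compat_l; lra.
  - rewrite !RtoC_mult, RtoC_div by lra. field.
    apply INR_pos_neq_0; lia.
Qed.

Lemma unit_root_power_sum (m k : nat) : (0 < k < m)%nat ->
  Csum_lt m (fun r => (unit_root m ^ r) ^ k) = 0.
Proof.
  intros H.
  apply (Cmult_eq_0_l _ (1 - unit_root m ^ k)).
  - intros E; apply (unit_root_pow_neq_1 m k H).
    replace (unit_root m ^ k) with (1 - (1 - unit_root m ^ k)) by ring. rewrite E; ring.
  - rewrite (Csum_lt_ext m _ (fun r => (unit_root m ^ k) ^ r)).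
    + rewrite Cmult_comm, Csum_lt_geom, <- Cpow_mult_r, Nat.mul_comm, Cpow_mult_r.
      rewrite unit_root_pow_order, Cpow_1_l by lia; ring.
    + intros r _; now rewrite <- !Cpow_mult_r, Nat.mul_comm.
Qed.

(** Dividing [a^m - b^m = a^m - (b zeta^r)^m] by [a - b zeta^r] leaves a polynomial in [zeta^r].
    Summed over [r], only the exponent [m] survives, all smaller positive power sums being zero. *)
Lemma unit_root_fraction_sum (m : nat) (a b : C) : (1 <= m)%nat ->
  (forall r, (r < m)%nat -> a - b * unit_root m ^ r <> 0) ->
  (a ^ m - b ^ m) * Csum_lt m (fun r => unit_root m ^ r / (a - b * unit_root m ^ r))
  = INR m * b ^ (m - 1).
Proof.
  intros Hm H. rewrite <- Csum_lt_scal.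
  rewrite (Csum_lt_ext m _ (fun r => Csum_lt m (fun j =>
    b ^ j * a ^ (m - 1 - j) * (unit_root m ^ r) ^ (j + 1)))).
  (* The last index [j = p] is split off: it alone has exponent [j + 1 = m]. *)
  - rewrite Csum_lt_swap. destruct m as [|p]; [lia|].
    set (z := unit_root (S p)). simpl Csum_lt at 1.
    rewrite (Csum_lt_ext p _ (fun _ => 0)).
    + rewrite Csum_lt_const. unfold z.
      replace (Csum_lt p (fun r => b ^ p * a ^ (p - 0 - p) * (unit_root (S p) ^ r) ^ (p + 1)) +
        b ^ p * a ^ (p - 0 - p) * (unit_root (S p) ^ p) ^ (p + 1))
        with (Csum_lt (S p) (fun r => b ^ p * a ^ (p - 0 - p) * (unit_root (S p) ^ r) ^ (p + 1)))
        by reflexivity.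
      rewrite (Csum_lt_ext _ _ (fun _ => b ^ p)).
      * rewrite Csum_lt_const. replace (S p - 1)%nat with p by lia. ring.
      * intros r _. rewrite <- Cpow_mult_r, Nat.mul_comm, Cpow_mult_r.
        replace (p + 1)%nat with (S p) by lia.
        rewrite unit_root_pow_order, Cpow_1_l by lia.
        replace (p - 0 - p)%nat with 0%nat by lia. simpl; ring.
    + intros j Hj.
      change (Csum_lt (S p) (fun r => b ^ j * a ^ (p - 0 - j) * (z ^ r) ^ (j + 1)) = 0).
      rewrite Csum_lt_scal, unit_root_power_sum by lia. ring.
  - intros r Hr. assert (H0 := H r Hr).
    assert (E := Csum_lt_sub_pow m a (b * unit_root m ^ r)).
    rewrite Cpow_mult_l, <- (Cpow_mult_r _ r m), Nat.mul_comm, Cpow_mult_r,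
      unit_root_pow_order, Cpow_1_l, Cmult_1_r in E by auto.
    rewrite <- E.
    rewrite (Csum_lt_ext m (fun j => _ * _ * (unit_root m ^ r) ^ (j + 1))
      (fun j => unit_root m ^ r * ((b * unit_root m ^ r) ^ j * a ^ (m - 1 - j)))).
    + rewrite Csum_lt_scal. field; auto.
    + intros j _. rewrite Cpow_mult_l, Cpow_add_r, Cpow_1_r. ring.
Qed.

(** * Power sums through cotangents and hyperbolic cotangents *)

Definition cot_sum (m : nat) (v : C) : C :=
  Csum_lt m (fun r => half_root m r * Ccot (PI * (v * half_root m r))).

Definition coth_sum (m : nat) (w : C) : C :=
  Csum_lt m (fun r => half_root m r * Ccoth (PI * (w * half_root m r))).

(** In the expansion at [v w^r] the numerator already carries [w^r]; the weight [w^r] turns it into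
    [w^(2r)], the power of the primitive [m]-th root of unity that [unit_root_fraction_sum]
    expects. *)
Lemma cot_power_sum (m : nat) (v : C) : (1 <= m)%nat ->
  (forall r, (r < m)%nat -> Csin (PI * (v * half_root m r)) <> 0) ->
  is_Cseries (fun n => / (INR (S n) ^ (2 * m) - v ^ (2 * m)))
    ((INR m - PI * v * cot_sum m v) / (2 * INR m * v ^ (2 * m))).
Proof.
  intros Hm H.
  assert (Hr : forall r, half_root m r <> 0) by (intros; apply Cexp_neq_0).
  assert (Hv : v <> 0).
  { intros E. apply (nonint_neq_0 _ (H 0%nat Hm)). rewrite E; ring. }
  assert (Hm0 := INR_pos_neq_0 m Hm).
  assert (Hfac : forall n r, (r < m)%nat ->
    INR (S n) ^ 2 - v ^ 2 * unit_root m ^ r <> 0).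
  { intros n r Hrm E. apply (nonint_sqr _ (S n) (H r Hrm)).
    rewrite Cpow_mult_l, half_root_sqr by auto.
    replace (v ^ 2 * unit_root m ^ r - INR (S n) ^ 2)
      with (- (INR (S n) ^ 2 - v ^ 2 * unit_root m ^ r)) by ring.
    rewrite E; ring. }
  assert (Hid : forall n, (INR (S n) ^ (2 * m) - v ^ (2 * m)) *
    Csum_lt m (fun r => unit_root m ^ r / (INR (S n) ^ 2 - v ^ 2 * unit_root m ^ r))
    = INR m * (v ^ 2) ^ (m - 1)).
  { intros n. rewrite !Cpow_mult_r. apply unit_root_fraction_sum; auto. }
  assert (Hv2 : (v ^ 2) ^ (m - 1) <> 0) by (apply Cpow_nz, Cpow_nz, Hv).
  (* The right side of [Hid] is nonzero, hence so is this factor of its left side. *)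
  assert (Hd : forall n, INR (S n) ^ (2 * m) - v ^ (2 * m) <> 0).
  { intros n E. specialize (Hid n). rewrite E, Cmult_0_l in Hid.
    symmetry in Hid; revert Hid. now apply Cmult_neq_0. }
  assert (Hs := is_Cseries_Csum_lt m
    (fun r n => half_root m r * cot_term (v * half_root m r) n)
    (fun r => half_root m r * (PI * Ccot (PI * (v * half_root m r)) - / (v * half_root m r)))).
  assert (Hs1 : forall r, (r < m)%nat ->
    is_Cseries (fun n => half_root m r * cot_term (v * half_root m r) n)
     (half_root m r * (PI * Ccot (PI * (v * half_root m r)) - / (v * half_root m r)))).
  { intros r Hrm. apply is_Cseries_scal, cot_expansion; auto. }
  specialize (Hs Hs1).
  apply (is_Cseries_scal (- / (2 * v * INR m * (v ^ 2) ^ (m - 1)))) in Hs.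
  match type of Hs with is_series _ ?l =>
    replace ((INR m - PI * v * cot_sum m v) / (2 * INR m * v ^ (2 * m))) with l end.
  - eapply is_Cseries_ext; [|exact Hs]. intros n; cbv beta.
    rewrite (Csum_lt_ext m _ (fun r => - (2 * v) *
      (unit_root m ^ r / (INR (S n) ^ 2 - v ^ 2 * unit_root m ^ r)))).
    + rewrite Csum_lt_scal. specialize (Hid n).
      replace (Csum_lt m (fun r => unit_root m ^ r / (INR (S n) ^ 2 - v ^ 2 * unit_root m ^ r)))
        with (INR m * (v ^ 2) ^ (m - 1) / (INR (S n) ^ (2 * m) - v ^ (2 * m)))
        by (rewrite <- Hid; field; apply Hd).
      assert (H1 := Hd n).
      set (d := INR (S n) ^ (2 * m) - v ^ (2 * m)) in *. clearbody d.
      set (q := (v ^ 2) ^ (m - 1)) in *. clearbody q.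
      field; repeat split; auto using C2_neq_0.
    + intros r Hrm. unfold cot_term. rewrite <- half_root_sqr by auto.
      assert (H1 := Hfac n r Hrm). rewrite <- half_root_sqr in H1 by auto.
      assert (H2 := nonint_sqr _ (S n) (H r Hrm)).
      set (a := INR (S n)) in *. clearbody a.
      rewrite <- Cpow_mult_l in *. field; auto.
  - rewrite (Csum_lt_ext m _ (fun r =>
      PI * (half_root m r * Ccot (PI * (v * half_root m r))) + - / v)).
    + rewrite Csum_lt_plus, Csum_lt_scal, Csum_lt_const. fold (cot_sum m v).
      replace (v ^ (2 * m)) with (v ^ 2 * (v ^ 2) ^ (m - 1)).
      * field; repeat split; auto using C2_neq_0.
      * rewrite <- Cpow_S, Cpow_mult_r; f_equal; lia.
    + intros r _. field; auto.
Qed.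

Lemma Csin_Ci (u : C) : Csin (Ci * u) = Ci * Csinh u.
Proof.
  unfold Csin, Csinh. replace (Ci * (Ci * u)) with (- u).
  - replace (- - u) with u by ring.
    replace (Ci * ((Cexp u - Cexp (- u)) / 2))
      with (Ci * Ci * ((Cexp u - Cexp (- u)) / (2 * Ci)))
      by (field; auto using Ci_neq_0, C2_neq_0).
    rewrite Ci2; field; auto using Ci_neq_0, C2_neq_0.
  - rewrite Cmult_assoc, Ci2; ring.
Qed.

Lemma Ccos_Ci (u : C) : Ccos (Ci * u) = Ccosh u.
Proof.
  unfold Ccos, Ccosh. replace (Ci * (Ci * u)) with (- u).
  - replace (- - u) with u by ring. f_equal; ring.
  - rewrite Cmult_assoc, Ci2; ring.
Qed.

Lemma Csinh_Cexp (u : C) : Csinh u = (Cexp (2 * u) - 1) / (2 * Cexp u).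
Proof.
  unfold Csinh. rewrite Cexp_opp, Cexp_double.
  field; repeat split; auto using C2_neq_0, Cexp_neq_0.
Qed.

Lemma Csinh_neq_0 (u : C) : Cexp (2 * u) - 1 <> 0 -> Csinh u <> 0.
Proof.
  intros H E; apply H. rewrite Csinh_Cexp in E.
  assert (H0 := Cexp_neq_0 u).
  replace (Cexp (2 * u) - 1) with ((Cexp (2 * u) - 1) / (2 * Cexp u) * (2 * Cexp u))
    by (field; auto using C2_neq_0).
  rewrite E; ring.
Qed.

Lemma Ccoth_Cexp (u : C) : Cexp (2 * u) - 1 <> 0 ->
  Ccoth u = 1 + 2 / (Cexp (2 * u) - 1).
Proof.
  intros H. unfold Ccoth. rewrite Csinh_Cexp. unfold Ccosh.
  rewrite Cexp_opp. rewrite Cexp_double in *.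
  field; repeat split; auto using C2_neq_0, Cexp_neq_0.
Qed.

(** [cot_power_sum] at [v = i w]; the sign is [(i w)^(2m) = (-1)^m w^(2m)]. *)
Lemma coth_power_sum (m : nat) (w : C) : (1 <= m)%nat ->
  (forall r, (r < m)%nat -> Csinh (PI * (w * half_root m r)) <> 0) ->
  is_Cseries (fun n => / (INR (S n) ^ (2 * m) - (-1) ^ m * w ^ (2 * m)))
    ((INR m - PI * w * coth_sum m w) / (2 * INR m * ((-1) ^ m * w ^ (2 * m)))).
Proof.
  intros Hm H.
  assert (Ea : forall r, PI * (Ci * w * half_root m r) = Ci * (PI * (w * half_root m r)))
    by (intros; ring).
  assert (E : (Ci * w) ^ (2 * m) = (-1) ^ m * w ^ (2 * m)).
  { rewrite Cpow_mult_l. f_equal. rewrite Cpow_mult_r. f_equal.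
    simpl; rewrite Cmult_1_r; apply Ci2. }
  rewrite <- E.
  replace (PI * w * coth_sum m w) with (PI * (Ci * w) * cot_sum m (Ci * w)).
  - apply cot_power_sum; auto. intros r Hr; rewrite Ea, Csin_Ci.
    apply Cmult_neq_0; [apply Ci_neq_0 | auto].
  - unfold cot_sum, coth_sum. rewrite <- !Csum_lt_scal. apply Csum_lt_ext; intros r Hr.
    assert (H0 := H r Hr).
    rewrite Ea. unfold Ccot, Ccoth. rewrite Csin_Ci, Ccos_Ci. field.
    repeat split; auto using Ci_neq_0.
Qed.

(** The summand [1] of [coth u = 1 + 2 / (e^(2u) - 1)] contributes the sum of the [half_root m r]:
    this is the origin of the factor [1 / (1 - exp(i pi / m))] in front of the plain series. *)
Lemma coth_sum_exp (m : nat) (w : C) : (1 <= m)%nat ->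
  (forall r, (r < m)%nat -> Cexp (2 * (PI * (w * half_root m r))) - 1 <> 0) ->
  coth_sum m w = 2 / (1 - Cexp (Ci * PI / INR m))
    + 2 * Csum_lt m (fun r => half_root m r / (Cexp (2 * (PI * (w * half_root m r))) - 1)).
Proof.
  intros Hm H. unfold coth_sum.
  rewrite <- half_root_sum, <- Csum_lt_scal, <- Csum_lt_plus by auto.
  apply Csum_lt_ext; intros r Hr.
  assert (H0 := H r Hr). rewrite Ccoth_Cexp by auto. field; auto.
Qed.

(** * Even zeta values *)

Lemma pseries_coef_unique (a b : nat -> R) (f : R -> R) (d : R) : (0 < d)%R ->
  (forall x, x <> 0%R -> (Rabs x < d)%R -> is_pseries a x (f x) /\ is_pseries b x (f x)) ->
  forall n, a n = b n.
Proof.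
  intros Hd H.
  assert (Hcv : forall a : nat -> R, (forall x, x <> 0%R -> (Rabs x < d)%R -> ex_pseries a x) ->
    Rbar_lt 0 (CV_radius (PS_incr_1 a))).
  { clear a b H; intros a Ha.
    destruct (Rbar_lt_le_dec (CV_radius (PS_incr_1 a)) (Rabs (d / 2))) as [Hlt|Hle].
    - exfalso; apply (CV_disk_outside _ _ Hlt), ex_series_lim_0.
      destruct (Ha (d / 2)%R) as [l Hl]; [lra | rewrite Rabs_pos_eq; lra |].
      exists (scal (d / 2)%R l).
      exact (proj1 (is_pseries_R _ _ _) (is_pseries_incr_1 a (d / 2)%R l Hl)).
    - eapply Rbar_lt_le_trans; [|exact Hle]. simpl. rewrite Rabs_pos_eq; lra. }
  intros n.
  apply (PSeries_ext_recip (PS_incr_1 a) (PS_incr_1 b) (S n)).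
  - apply Hcv; intros x H1 H2; eexists; apply (H x H1 H2).
  - apply Hcv; intros x H1 H2; eexists; apply (H x H1 H2).
  - exists (mkposreal d Hd). intros x Hx.
    change (Rabs (x - 0) < d)%R in Hx. rewrite Rminus_0_r in Hx.
    rewrite !PSeries_incr_1.
    destruct (Req_dec x 0) as [->|Hn]; [ring|].
    destruct (H x Hn Hx) as [H1 H2].
    now rewrite (is_pseries_unique _ _ _ H1), (is_pseries_unique _ _ _ H2).
Qed.

Definition even_zeta (m : nat) : R := Series (fun n => / INR (S n) ^ (2 * m))%R.

Lemma even_zeta_correct (m : nat) : (1 <= m)%nat ->
  is_series (fun n => / INR (S n) ^ (2 * m))%R (even_zeta m).
Proof.
  intros Hm; apply Series_correct.
  apply (ex_series_le (V := R_CompleteNormedModule) _ (fun n => / INR (S n) ^ 2)%R).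
  - intros n. change (Rabs (/ INR (S n) ^ (2 * m)) <= / INR (S n) ^ 2)%R.
    assert (H : (1 <= INR (S n))%R) by (apply (le_INR 1); lia).
    rewrite Rabs_pos_eq by (left; apply Rinv_0_lt_compat, pow_lt; lra).
    apply Rinv_le_contravar; [apply pow_lt; lra|]. apply Rle_pow; auto; lia.
  - apply ex_series_inv_sqr.
Qed.

(** The cotangent expansion at [i s], multiplied by [2 i s] so that every term is real. *)
Lemma coth_real_expansion (s : R) : (s <> 0)%R ->
  is_series (fun n => 4 * s ^ 2 / (INR (S n) ^ 2 + s ^ 2))%R
    (2 * PI * s * (1 + 2 / (exp (2 * PI * s) - 1)) - 2)%R.
Proof.
  intros Hs. assert (HPI := PI_RGT_0).
  assert (He : exp (2 * PI * s) <> 1%R).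
  { intros E. rewrite <- exp_0 in E. apply exp_inv in E.
    apply Rmult_integral in E; destruct E; lra. }
  assert (HeC : Cexp (2 * (PI * s)) - 1 <> 0).
  { replace (2 * (PI * s)) with (RtoC (2 * PI * s)) by (rewrite !RtoC_mult; ring).
    rewrite Cexp_RtoC, <- RtoC_minus. intros E; apply RtoC_inj in E. lra. }
  assert (Ez : PI * (Ci * s) = Ci * (PI * s)) by ring.
  assert (HsC : RtoC s <> 0) by (intros E; apply RtoC_inj in E; lra).
  assert (H : Csin (PI * (Ci * s)) <> 0).
  { rewrite Ez, Csin_Ci. apply Cmult_neq_0; [apply Ci_neq_0 | now apply Csinh_neq_0]. }
  assert (E := is_Cseries_scal (2 * s * Ci) _ _ (cot_expansion _ H)).
  assert (EF : PI * Ccot (PI * (Ci * s)) = - (Ci * PI) * Ccoth (PI * s)).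
  { rewrite Ez. unfold Ccot, Ccoth. rewrite Csin_Ci, Ccos_Ci.
    assert (HS := Csinh_neq_0 _ HeC).
    transitivity (- (Ci * PI) * (Ccosh (PI * s) / Csinh (PI * s)) * (- / (Ci * Ci))).
    - field; auto using Ci_neq_0.
    - rewrite Ci2. field; auto. }
  rewrite EF, (Ccoth_Cexp _ HeC) in E.
  apply is_Cseries_ext with
    (b := fun n => RtoC (4 * s ^ 2 / (INR (S n) ^ 2 + s ^ 2))%R) in E.
  - apply is_Cseries_Re_Im in E. destruct E as [E _].
    match type of E with is_series _ (Re ?l) =>
      replace l with (RtoC (2 * PI * s * (1 + 2 / (exp (2 * PI * s) - 1)) - 2)%R) in E end.
    + exact E.
    + replace (2 * (PI * s)) with (RtoC (2 * PI * s)) in * by (rewrite !RtoC_mult; ring).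
      rewrite Cexp_RtoC in *.
      rewrite RtoC_minus, !RtoC_mult, RtoC_plus, RtoC_div, RtoC_minus by lra.
      set (e := RtoC (exp (2 * PI * s))) in *. clearbody e.
      replace (2 * s * Ci * (- (Ci * PI) * (1 + 2 / (e - 1)) - / (Ci * s)))
        with (2 * s * (- (Ci * Ci) * PI) * (1 + 2 / (e - 1)) - 2)
        by (field; auto using Ci_neq_0).
      rewrite Ci2. field; auto.
  - intros n; unfold cot_term; cbv beta.
    assert (Hn : (0 < INR (S n) ^ 2)%R) by (apply pow_lt, lt_0_INR; lia).
    assert (Hs2 : (0 <= s ^ 2)%R) by apply pow2_ge_0.
    assert (Hd : RtoC (INR (S n)) ^ 2 + s ^ 2 <> 0).
    { rewrite <- !RtoC_pow, <- RtoC_plus. intros D; apply RtoC_inj in D; lra. }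
    rewrite RtoC_div, RtoC_mult, RtoC_plus, !RtoC_pow by lra.
    set (a := RtoC (INR (S n))) in *. clearbody a.
    replace ((Ci * s) ^ 2 - a ^ 2) with (Ci * Ci * s ^ 2 - a ^ 2) by ring.
    replace (2 * s * Ci * (2 * (Ci * s) / (Ci * Ci * s ^ 2 - a ^ 2)))
      with (Ci * Ci * (4 * s ^ 2) * / (Ci * Ci * s ^ 2 - a ^ 2)) by (unfold Cdiv; ring).
    rewrite Ci2.
    replace (-1 * s ^ 2 - a ^ 2) with (- (a ^ 2 + s ^ 2)) by ring.
    field; auto.
Qed.

(** The Taylor coefficients of [2 pi s coth(pi s)] in the variable [s^2]. *)
Definition coth_coef (j : nat) : R :=
  match j with
  | O => 2
  | S i => 4 * (-1) ^ i * even_zeta j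
  end.

(** Each [4 s^2 / (n^2 + s^2)] is expanded as a geometric series in [- s^2 / n^2], and the two
    summations are exchanged. *)
Lemma coth_pseries (s : R) : (s <> 0)%R -> (Rabs s <= / 2)%R ->
  is_pseries coth_coef (s ^ 2)%R (2 * PI * s * (1 + 2 / (exp (2 * PI * s) - 1)))%R.
Proof.
  intros Hs Hsmall.
  set (V := (2 * PI * s * (1 + 2 / (exp (2 * PI * s) - 1)))%R).
  assert (Hs2 : (0 <= s ^ 2 <= / 2)%R).
  { split; [apply pow2_ge_0|]. rewrite <- pow2_abs. assert (H := Rabs_pos s). nra. }
  set (y := (s ^ 2)%R) in *.
  set (a := fun n j : nat => (4 * y / INR (S n) ^ 2 * (- (y / INR (S n) ^ 2)) ^ j)%R).
  assert (Hn1 : forall n, (1 <= INR (S n) ^ 2)%R).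
  { intros n; apply pow_R1_Rle, (le_INR 1); lia. }
  assert (Hq : forall n, (0 <= y / INR (S n) ^ 2 <= / 2)%R).
  { intros n; specialize (Hn1 n); split.
    - apply Rmult_le_pos; [lra|]. left; apply Rinv_0_lt_compat; lra.
    - apply Rle_div_l; lra. }
  assert (Hgeo : forall L, (sum_n (fun j => (/ 2) ^ j) L <= 2)%R).
  { intros L. apply sum_n_le_series; [intros; apply pow_le; lra|].
    assert (G := is_series_geom (/ 2)). rewrite Rabs_pos_eq in G by lra.
    replace (/ (1 - / 2))%R with 2%R in G by field. apply G; lra. }
  (* From [y <= 1/2], the [n]-th row is at most [2 / n^2] times a geometric sum at most [2], and the
     sum of [1 / n^2] is at most [2]: in all [8]. *)
  destruct (fubini_R a 8) as [_ [_ [l [Hrow Hcol]]]].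
  { intros K L. apply Rle_trans with
      (sum_n (fun n => scal 4%R (/ INR (S n) ^ 2)%R) K).
    - apply sum_n_le_compat; intros n _.
      apply Rle_trans with
        (sum_n (fun j => scal (2 * / INR (S n) ^ 2)%R ((/ 2) ^ j)%R) L).
      + apply sum_n_le_compat; intros j _.
        change (Rabs (a n j) <= 2 * / INR (S n) ^ 2 * (/ 2) ^ j)%R. unfold a.
        rewrite Rabs_mult, <- RPow_abs, Rabs_Ropp, (Rabs_pos_eq (y / _)) by apply Hq.
        assert (H1 := Hn1 n).
        assert (H2 : (0 < / INR (S n) ^ 2)%R) by (apply Rinv_0_lt_compat; lra).
        rewrite Rabs_pos_eq by (apply Rmult_le_pos; lra).
        apply Rmult_le_compat.
        * apply Rmult_le_pos; lra.
        * apply pow_le, Hq.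
        * unfold Rdiv; apply Rmult_le_compat_r; lra.
        * apply pow_incr, Hq.
      + rewrite sum_n_scal_l.
        change (2 * / INR (S n) ^ 2 * sum_n (fun j => (/ 2) ^ j)%R L
                <= 4 * / INR (S n) ^ 2)%R.
        assert (H1 := Hn1 n).
        assert (H2 : (0 < / INR (S n) ^ 2)%R) by (apply Rinv_0_lt_compat; lra).
        assert (H3 := Hgeo L). nra.
    - rewrite sum_n_scal_l.
      change (4 * sum_n (fun n => / INR (S n) ^ 2)%R K <= 8)%R.
      assert (H1 := sum_inv_sqr_le K).
      assert (0 < / INR (S K))%R by (apply Rinv_0_lt_compat, lt_0_INR; lia). lra. }
  assert (El : l = (V - 2)%R).
  { assert (Ec := is_series_unique _ _ (coth_real_expansion s Hs)). fold V in Ec.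
    rewrite <- (is_series_unique _ _ Hrow), <- Ec.
    apply Series_ext; intros n. unfold a.
    specialize (Hn1 n). specialize (Hq n).
    rewrite Series_scal_l, Series_geom by (rewrite Rabs_Ropp, Rabs_pos_eq; lra).
    fold y. set (b := (INR (S n) ^ 2)%R) in *. clearbody b. field. lra. }
  apply is_pseries_R. apply (is_series_decr_1 (V := R_NormedModule)).
  change (plus V (opp (coth_coef 0 * y ^ 0)%R)) with (V + - (2 * 1))%R.
  assert (El' : (V + - (2 * 1))%R = l) by (rewrite El; ring).
  rewrite El'.
  eapply is_series_ext; [|exact Hcol].
  intros j; cbv beta.
  rewrite (Series_ext _ (fun n => 4 * (-1) ^ j * y ^ S j * / INR (S n) ^ (2 * S j))%R).
  - rewrite Series_scal_l. unfold coth_coef, even_zeta. 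
    change (4 * (-1) ^ j * y ^ S j * Series (fun n => / INR (S n) ^ (2 * S j))
            = 4 * (-1) ^ j * Series (fun n => / INR (S n) ^ (2 * S j)) * y ^ S j)%R.
    ring.
  - intros n. unfold a. specialize (Hn1 n).
    rewrite pow_mult. set (b := (INR (S n) ^ 2)%R) in *.
    replace (- (y / b))%R with (-1 * y * / b)%R by (field; lra).
    rewrite !Rpow_mult_distr, pow_inv. simpl pow. field. split; [apply pow_nonzero; lra | lra].
Qed.

(** Euler's formula. The generating function at [2 pi s] plus its value at [- 2 pi s] is
    [2 pi s coth(pi s)] for small real [s], whose coefficients are also given by [coth_pseries]. *)
Lemma bernoulli_zeta (B : nat -> R) (hB : is_bernoulli B) (m : nat) : (1 <= m)%nat ->
  (B (2 * m)%nat * (2 * PI) ^ (2 * m) / INR (fact (2 * m))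
   = 2 * (-1) ^ (m - 1) * even_zeta m)%R.
Proof.
  intros Hm. destruct hB as [rho HB]. assert (HPI := PI_RGT_0).
  set (a := fun k => (B k / INR (fact k))%R).
  assert (Ha : forall x, (x <> 0)%R -> (Rabs x < rho)%R ->
    is_series (fun k => a k * x ^ k)%R (x / (exp x - 1))%R).
  { intros x Hx Hr.
    assert (He : exp x <> 1%R).
    { intros E. rewrite <- exp_0 in E. apply exp_inv in E. lra. }
    assert (H := HB x). rewrite Cmod_R in H.
    assert (HxC : RtoC x <> 0) by (intros E; apply RtoC_inj in E; lra).
    specialize (H HxC Hr).
    apply is_Cseries_ext with (b := fun k => RtoC (a k * x ^ k)) in H.
    - apply is_Cseries_Re_Im in H. destruct H as [H _].
      replace (x / (Cexp x - 1)) with (RtoC (x / (exp x - 1))) in H; [exact H|].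
      rewrite Cexp_RtoC, RtoC_div, RtoC_minus by lra. reflexivity.
    - intros k. assert (Hf := INR_fact_neq_0 k). unfold a.
      rewrite RtoC_mult, RtoC_div, RtoC_pow by auto.
      assert (RtoC (INR (fact k)) <> 0) by (intros E; apply RtoC_inj in E; auto).
      field; auto. }
  (* Rescaled even part of the generating function: [x coth (x / 2)] at [x = 2 pi s]. *)
  set (f := fun s => (2 * PI * s * (1 + 2 / (exp (2 * PI * s) - 1)))%R).
  set (a' := fun k => ((1 + (-1) ^ k) * (2 * PI) ^ k * a k)%R).
  (* [coth_coef] is a sequence in powers of [s^2]; zeros are inserted in odd degree so that both
     series are in powers of [s]. *)
  set (b := fun k => if Nat.even k then coth_coef (Nat.div2 k) else 0%R).
  assert (Hb : forall m, b (2 * m)%nat = coth_coef m).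
  { intros k; unfold b. rewrite Nat.even_mul, Nat.div2_double; reflexivity. }
  assert (E : a' (2 * m)%nat = b (2 * m)%nat).
  { apply (pseries_coef_unique a' b f (Rmin (/ 2) (rho / (2 * PI)))).
    { apply Rmin_pos; [lra|]. apply Rdiv_lt_0_compat; [apply cond_pos | lra]. }
    intros s Hs Hr. split.
    - assert (Hx : (2 * PI * s)%R <> 0%R).
      { intros E; apply Rmult_integral in E; destruct E; lra. }
      assert (Hxr : (Rabs (2 * PI * s) < rho)%R).
      { rewrite Rabs_mult, (Rabs_pos_eq (2 * PI)) by lra.
        assert (H := Rlt_le_trans _ _ _ Hr (Rmin_r _ _)).
        apply Rlt_div_r in H; lra. }
      assert (H1 := Ha _ Hx Hxr).
      assert (H2 := Ha (- (2 * PI * s))%R).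
      rewrite Rabs_Ropp in H2. assert (Hx' : (- (2 * PI * s) <> 0)%R) by lra.
      specialize (H2 Hx' Hxr).
      assert (H3 := is_series_plus (V := R_NormedModule) _ _ _ _ H1 H2).
      apply is_pseries_R.
      match type of H3 with is_series _ ?l => replace (f s) with l end.
      + eapply is_series_ext; [|exact H3]. intros k.
        change (a k * (2 * PI * s) ^ k + a k * (- (2 * PI * s)) ^ k = a' k * s ^ k)%R.
        replace (- (2 * PI * s))%R with ((-1) * (2 * PI * s))%R by ring.
        unfold a'. rewrite !(Rpow_mult_distr _ s), (Rpow_mult_distr (-1)), (Rpow_mult_distr _ s).
        ring.
      + change (2 * PI * s / (exp (2 * PI * s) - 1)
                + - (2 * PI * s) / (exp (- (2 * PI * s)) - 1) = f s)%R.
        unfold f. rewrite exp_Ropp.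
        assert (He : exp (2 * PI * s) <> 1%R).
        { intros E. rewrite <- exp_0 in E. apply exp_inv in E. lra. }
        assert (He0 := exp_pos (2 * PI * s)).
        field. lra.
    - replace (f s) with (f s + s * 0)%R by ring.
      apply is_pseries_odd_even.
      + apply (is_pseries_ext coth_coef); [intros k; now rewrite Hb|].
        apply coth_pseries; auto. left; eapply Rlt_le_trans; [exact Hr | apply Rmin_l].
      + apply is_pseries_R. apply filterlim_ext with (fun _ : nat => 0%R); [|apply filterlim_const].
        intros k. rewrite (sum_n_ext _ (fun _ => 0%R)); [rewrite sum_n_const; ring|].
        intros j; unfold b. rewrite Nat.even_add, Nat.even_mul. simpl. ring. }
  rewrite Hb in E. unfold a', a in E.
  destruct m as [|i]; [lia|]. replace (S i - 1)%nat with i by lia.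
  unfold coth_coef in E.
  replace ((-1) ^ (2 * S i))%R with 1%R in E.
  - assert (Hf := INR_fact_neq_0 (2 * S i)).
    apply (Rmult_eq_reg_l 2); [|lra].
    transitivity (4 * (-1) ^ i * even_zeta (S i))%R; [|ring].
    rewrite <- E. field; auto.
  - rewrite pow_mult. replace ((-1) ^ 2)%R with 1%R by ring. now rewrite pow1.
Qed.

(** * Absolute summability of the double series *)

Lemma is_Cseries_single (p : nat) (c : C) :
  is_Cseries (fun n => if Nat.eqb n p then c else RtoC 0) c.
Proof.
  apply filterlim_ext_loc with (fun _ : nat => c : C_NormedModule); [|apply filterlim_const].
  exists p; intros n Hn.
  assert (E : forall n, sum_n (G := C_NormedModule) (fun n => if Nat.eqb n p then c else RtoC 0) n
    = if Nat.leb p n then c else RtoC 0).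
  { clear n Hn. induction n as [|n IH].
    - rewrite sum_O. destruct p; reflexivity.
    - rewrite sum_Sn, IH.
      destruct (Nat.eqb_spec (S n) p), (Nat.leb_spec p n), (Nat.leb_spec p (S n));
        try lia; first [exact (Cplus_0_l _) | exact (Cplus_0_r _)]. }
  rewrite E. destruct (Nat.leb_spec p n); [reflexivity | lia].
Qed.

(** The exceptional term equals the total [l] minus the others, so its modulus is at most [|l| + b],
    however small its denominator may be. *)
Lemma sum_Cmod_single_exception (t : nat -> C) (p : nat) (l : C) (b : R) :
  (forall K, sum_n (fun n => if Nat.eqb n p then 0%R else Cmod (t n)) K <= b)%R ->
  is_Cseries t l -> forall K, (sum_n (fun n => Cmod (t n)) K <= Cmod l + 2 * b)%R.
Proof.
  intros HS HR K.
  assert (Hp : (Cmod (t p) <= Cmod l + b)%R).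
  { assert (H := is_Cseries_plus _ _ _ _ HR
      (is_Cseries_scal (-1) _ _ (is_Cseries_single p (t p)))).
    apply (is_Cseries_Cmod_le _ _ b) in H.
    - assert (T := Cmod_triangle (l + -1 * t p) (- l)). rewrite Cmod_opp in T.
      replace (l + -1 * t p + - l) with (- t p) in T by ring. rewrite Cmod_opp in T. lra.
    - intros L. eapply Rle_trans; [|apply (HS L)]. apply sum_n_le_compat; intros n _.
      destruct (Nat.eqb_spec n p) as [->|_].
      + replace (t p + -1 * t p) with (RtoC 0) by ring. rewrite Cmod_0; lra.
      + right; f_equal; ring. }
  assert (E : (sum_n (fun n => Cmod (t n)) K
    <= sum_n (fun n => if Nat.eqb n p then 0%R else Cmod (t n)) K + Cmod (t p))%R).
  { assert (Hc := Cmod_ge_0 (t p)).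
    assert (E : (sum_n (fun n => Cmod (t n)) K
      <= sum_n (fun n => if Nat.eqb n p then 0%R else Cmod (t n)) K
         + if Nat.leb p K then Cmod (t p) else 0)%R).
    { clear HS HR Hp. induction K as [|K IH].
      - rewrite !sum_O. destruct p; simpl; lra.
      - rewrite !sum_Sn.
        change (sum_n (fun n => Cmod (t n)) K + Cmod (t (S K))
          <= sum_n (fun n => if Nat.eqb n p then 0 else Cmod (t n)) K
             + (if Nat.eqb (S K) p then 0 else Cmod (t (S K)))
             + if Nat.leb p (S K) then Cmod (t p) else 0)%R.
        destruct (Nat.eqb_spec (S K) p) as [He|Hne], (Nat.leb_spec p K),
          (Nat.leb_spec p (S K)); try lia; try rewrite He; lra. }
    destruct (Nat.leb p K); lra. }
  specialize (HS K). lra.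
Qed.

Lemma root_exists (x : R) (m : nat) : (0 <= x)%R -> (1 <= m)%nat ->
  exists u, (0 <= u)%R /\ (u ^ m = x)%R.
Proof.
  intros [Hx|<-] Hm.
  - exists (Rpower x (/ INR m)); split; [left; apply exp_pos|].
    rewrite <- Rpower_pow by apply exp_pos.
    rewrite Rpower_mult, Rinv_l, Rpower_1; auto. apply not_0_INR; lia.
  - exists 0%R; split; [lra|]. apply pow_i; lia.
Qed.

Lemma pow_sub_ge (X Y : R) (m : nat) : (1 <= X)%R -> (0 <= Y)%R -> (1 <= m)%nat ->
  (Rabs (X - Y) <= Rabs (X ^ m - Y ^ m))%R.
Proof.
  intros HX HY Hm. destruct m as [|m]; [lia|]. clear Hm.
  induction m as [|m IH]; [rewrite !pow_1; lra|].
  assert (H0 : (0 <= Y ^ S m)%R) by (apply pow_le; auto).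
  assert (H1 : (1 <= X ^ S m)%R) by (apply pow_R1_Rle; auto).
  change (X ^ S (S m))%R with (X * X ^ S m)%R. change (Y ^ S (S m))%R with (Y * Y ^ S m)%R.
  set (a := (X ^ S m)%R) in *. set (b := (Y ^ S m)%R) in *.
  destruct (Rle_lt_dec Y X) as [H|H].
  - rewrite Rabs_pos_eq in * by lra.
    assert (b <= a)%R by (apply pow_incr; lra). rewrite Rabs_pos_eq by nra. nra.
  - rewrite Rabs_left in * by lra.
    assert (a <= b)%R by (apply pow_incr; lra). rewrite Rabs_left1 by nra. nra.
Qed.

(** A chain of lower bounds: [|n^(2m) - u^(2m)|] by the triangle inequality, then [|n^2 - u^2|],
    then [(n - u)^2], with [n] standing for [S n]. Only the modulus of [z] enters. *)
Lemma Cmod_pow_sub_ge (m n : nat) (z : C) (u : R) : (1 <= m)%nat -> (0 <= u)%R ->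
  (u ^ (2 * m) = Cmod z)%R ->
  ((INR (S n) - u) ^ 2 <= Cmod (INR (S n) ^ (2 * m) - z))%R.
Proof.
  intros Hm Hu E.
  assert (Hn : (1 <= INR (S n))%R) by (apply (le_INR 1); lia).
  set (k := INR (S n)) in *.
  assert (T : (Rabs (k ^ (2 * m) - u ^ (2 * m)) <= Cmod (k ^ (2 * m) - z))%R).
  { rewrite E.
    assert (Ek : Cmod (RtoC k ^ (2 * m)) = (k ^ (2 * m))%R).
    { rewrite Cmod_pow, Cmod_R, Rabs_pos_eq; lra. }
    assert (T1 := Cmod_triangle (RtoC k ^ (2 * m) - z) z).
    assert (T2 := Cmod_triangle (- (RtoC k ^ (2 * m) - z)) (RtoC k ^ (2 * m))).
    rewrite Cmod_opp in T2.
    replace (RtoC k ^ (2 * m) - z + z) with (RtoC k ^ (2 * m)) in T1 by ring.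
    replace (- (RtoC k ^ (2 * m) - z) + RtoC k ^ (2 * m)) with z in T2 by ring.
    apply Rabs_le; lra. }
  eapply Rle_trans; [|exact T].
  rewrite !pow_mult.
  eapply Rle_trans; [|apply pow_sub_ge; [nra | apply pow2_ge_0 | auto]].
  replace (k ^ 2 - u ^ 2)%R with ((k - u) * (k + u))%R by ring.
  rewrite Rabs_mult, <- (pow2_abs (k - u)), (Rabs_pos_eq (k + u)) by lra.
  assert (Ha := Rabs_pos (k - u)).
  assert (Rabs (k - u) <= k + u)%R by (apply Rabs_le; lra). nra.
Qed.

(* All indices but the one closest to [Cmod z ^ (1 / 2m)] contribute boundedly. *)
Lemma sum_Cmod_inv_pow_sub_le (m : nat) (z l : C) : (1 <= m)%nat ->
  (forall n, INR (S n) ^ (2 * m) - z <> 0) ->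
  is_Cseries (fun n => / (INR (S n) ^ (2 * m) - z)) l ->
  forall K, (sum_n (fun n => Cmod (/ (INR (S n) ^ (2 * m) - z))) K <= Cmod l + 64)%R.
Proof.
  intros Hm Hz HR.
  destruct (root_exists (Cmod z) (2 * m)) as [u [Hu Eu]]; [apply Cmod_ge_0 | lia |].
  (* [n0] is an integer nearest to [u]. Terms are indexed by [S n], so the exceptional index is
     [pred n0]; if [n0 = 0], no term needs to be excepted and singling out index [0] is harmless. *)
  destruct (nfloor_ex (u + / 2)) as [n0 Hn0]; [lra|].
  set (p := pred n0).
  (* With [d = S n - n0], [g n - g (S n)] is [1 / (d - 1/2) - 1 / (d + 1/2) = 1 / (d^2 - 1/4)], a
     telescoping majorant of [1 / d^2]. *)
  set (g := fun n => (/ (INR (S n) - INR n0 - / 2))%R).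
  assert (Hint : forall n, (INR (S n) - INR n0 <= 0 \/ 1 <= INR (S n) - INR n0)%R).
  { intros n; destruct (le_lt_dec (S n) n0) as [H|H].
    - left; apply le_INR in H; lra.
    - right; apply Nat.le_succ_l, le_INR in H. rewrite (S_INR n0) in H. lra. }
  assert (Hg : forall n, (-2 <= g n <= 2)%R).
  { intros n; unfold g. destruct (Hint n) as [H|H].
    - set (d := (INR (S n) - INR n0)%R) in *.
      replace (d - / 2)%R with (- (/ 2 - d))%R by ring. rewrite Rinv_opp.
      assert (0 < / (/ 2 - d))%R by (apply Rinv_0_lt_compat; lra).
      assert (/ (/ 2 - d) <= / / 2)%R by (apply Rinv_le_contravar; lra).
      rewrite Rinv_inv in *. lra.
    - set (d := (INR (S n) - INR n0)%R) in *.
      assert (0 < / (d - / 2))%R by (apply Rinv_0_lt_compat; lra).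
      assert (/ (d - / 2) <= / / 2)%R by (apply Rinv_le_contravar; lra).
      rewrite Rinv_inv in *. lra. }
  (* Away from [n0], [|S n - u| >= |d| - 1/2 >= |d| / 2], whence the factor [4]. At [p] the
     telescoping difference may be as low as [-4], and the added [16] compensates it. *)
  assert (Hb : forall n, ((if Nat.eqb n p then 0%R else Cmod (/ (INR (S n) ^ (2 * m) - z)))
     <= 4 * (g n - g (S n)) + if Nat.eqb n p then 16 else 0)%R).
  { intros n. destruct (Nat.eqb_spec n p) as [_|Hne].
    - assert (H1 := Hg n). assert (H2 := Hg (S n)). lra.
    - assert (Hne' : S n <> n0) by (unfold p in Hne; lia).
      rewrite Rplus_0_r, Cmod_inv by auto.
      assert (H := Cmod_pow_sub_ge m n z u Hm Hu Eu).
      unfold g. rewrite (S_INR (S n)).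
      assert (Hd : (INR (S n) - INR n0 <= -1 \/ 1 <= INR (S n) - INR n0)%R).
      { destruct (le_lt_dec n0 (S n)) as [Hl|Hl].
        - right. assert (Hl' : (S n0 <= S n)%nat) by lia.
          apply le_INR in Hl'; rewrite (S_INR n0) in Hl'; lra.
        - left. apply Nat.le_succ_l, le_INR in Hl. rewrite (S_INR (S n)) in Hl. lra. }
      set (d := (INR (S n) - INR n0)%R) in *.
      replace (INR (S n) + 1 - INR n0 - / 2)%R with (d + / 2)%R by (unfold d; lra).
      assert (Hd2 : (1 <= d * d)%R) by nra.
      assert (Hdu : (d * d / 4 <= (INR (S n) - u) ^ 2)%R).
      { replace (INR (S n) - u)%R with (d - (u - INR n0))%R by (unfold d; ring).
        assert (- / 2 <= u - INR n0 <= / 2)%R by lra.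
        set (h := (u - INR n0)%R) in *. destruct Hd; nra. }
      apply Rle_trans with (/ (d * d / 4))%R; [apply Rinv_le_contravar; lra|].
      replace (4 * (/ (d - / 2) - / (d + / 2)))%R with (/ (d * d / 4 - / 16))%R
        by (field; split; [|split]; nra).
      apply Rinv_le_contravar; lra. }
  intros K.
  (* The bound is [32]: at most [4 * 4] from the ends of the telescope and [16] from the exceptional
     index. *)
  apply Rle_trans with (Cmod l + 2 * 32)%R; [|lra].
  apply (sum_Cmod_single_exception _ p); auto. clear K; intros K.
  eapply Rle_trans; [apply sum_n_le_compat; intros n _; apply Hb|].
  assert (E : (sum_n (fun n => 4 * (g n - g (S n)) + if Nat.eqb n p then 16 else 0)%R K
    <= 4 * (g 0%nat - g (S K)) + if Nat.leb p K then 16 else 0)%R).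
  { induction K as [|K IH].
    - rewrite sum_O. destruct p; simpl; lra.
    - rewrite sum_Sn.
      change (sum_n (fun n => 4 * (g n - g (S n)) + if Nat.eqb n p then 16 else 0)%R K
        + (4 * (g (S K) - g (S (S K))) + if Nat.eqb (S K) p then 16 else 0)
        <= 4 * (g 0%nat - g (S (S K))) + if Nat.leb p (S K) then 16 else 0)%R.
      eapply Rle_trans; [apply Rplus_le_compat_r; apply IH|].
      destruct (Nat.eqb_spec (S K) p), (Nat.leb_spec p K), (Nat.leb_spec p (S K));
        try lia; lra. }
  assert (H1 := Hg 0%nat). assert (H2 := Hg (S K)).
  eapply Rle_trans; [apply E|]. destruct (Nat.leb p K); lra.
Qed.

(** Since [64] does not depend on [z k], row [k] costs at most [|q_k r_k| + 64 |q_k|], and both of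
    these are summable. *)
Lemma double_series_bounded (m : nat) (q z r : nat -> C) : (1 <= m)%nat ->
  (forall k n, INR (S n) ^ (2 * m) - z k <> 0) ->
  (forall k, is_Cseries (fun n => / (INR (S n) ^ (2 * m) - z k)) (r k)) ->
  ex_series (fun k => Cmod (q k)) -> ex_series (fun k => Cmod (q k * r k)) ->
  exists b : R, forall K L, (sum_n (fun k => sum_n (fun n =>
    Cmod (q k * / (INR (S n) ^ (2 * m) - z k))) L) K <= b)%R.
Proof.
  intros Hm Hz HR [lq Hq] [lr Hr].
  exists (lr + 64 * lq)%R. intros K L.
  apply Rle_trans with (sum_n (fun k => plus (Cmod (q k * r k)) (64 * Cmod (q k))%R) K).
  - apply sum_n_le_compat; intros k _.
    rewrite (sum_n_ext _ (fun n => Cmod (q k) * Cmod (/ (INR (S n) ^ (2 * m) - z k)))%R)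
      by (intros n; apply Cmod_mult).
    rewrite sum_n_Rmult_l.
    change (Cmod (q k) * sum_n (fun n => Cmod (/ (INR (S n) ^ (2 * m) - z k))) L
            <= Cmod (q k * r k) + 64 * Cmod (q k))%R.
    rewrite Cmod_mult.
    assert (H := sum_Cmod_inv_pow_sub_le m (z k) (r k) Hm (Hz k) (HR k) L).
    assert (H0 := Cmod_ge_0 (q k)).
    eapply Rle_trans; [apply Rmult_le_compat_l; [auto | apply H]|]. lra.
  - rewrite sum_n_plus, sum_n_Rmult_l.
    change (sum_n (fun k => Cmod (q k * r k)) K + 64 * sum_n (fun k => Cmod (q k)) K
            <= lr + 64 * lq)%R.
    assert (H1 := sum_n_le_series _ lq K (fun k => Cmod_ge_0 (q k)) Hq).
    assert (H2 := sum_n_le_series _ lr K (fun k => Cmod_ge_0 (q k * r k)) Hr). lra.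
Qed.

Lemma ex_series_Cmod_le (a b : nat -> C) :
  (forall n, Cmod (a n) <= Cmod (b n))%R ->
  ex_series (fun n => Cmod (b n)) -> ex_series (fun n => Cmod (a n)).
Proof.
  intros H. apply (ex_series_le (V := R_CompleteNormedModule)).
  intros n. change (Rabs (Cmod (a n)) <= Cmod (b n))%R.
  rewrite Rabs_pos_eq by apply Cmod_ge_0. apply H.
Qed.

Lemma ex_series_Cmod_ext (a b : nat -> C) :
  (forall n, a n = b n) -> ex_series (fun n => Cmod (a n)) -> ex_series (fun n => Cmod (b n)).
Proof. intros H; apply ex_series_Cmod_le; intros n; rewrite H; lra. Qed.

Lemma ex_series_Cmod_plus (a b : nat -> C) :
  ex_series (fun n => Cmod (a n)) -> ex_series (fun n => Cmod (b n)) ->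
  ex_series (fun n => Cmod (a n + b n)).
Proof.
  intros Ha Hb.
  apply (ex_series_le (V := R_CompleteNormedModule) _ (fun n => plus (Cmod (a n)) (Cmod (b n)))).
  - intros n. change (Rabs (Cmod (a n + b n)) <= Cmod (a n) + Cmod (b n))%R.
    rewrite Rabs_pos_eq by apply Cmod_ge_0. apply Cmod_triangle.
  - now apply (ex_series_plus (V := R_NormedModule)).
Qed.

Lemma ex_series_Cmod_scal (c : C) (a : nat -> C) :
  ex_series (fun n => Cmod (a n)) -> ex_series (fun n => Cmod (c * a n)).
Proof.
  intros Ha. apply (ex_series_ext (fun n => scal (Cmod c) (Cmod (a n)))).
  - intros n; now rewrite Cmod_mult.
  - now apply (ex_series_scal (V := R_NormedModule)).
Qed.

Lemma ex_series_Cmod_Csum_lt (m : nat) (a : nat -> nat -> C) :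
  (forall r, (r < m)%nat -> ex_series (fun n => Cmod (a r n))) ->
  ex_series (fun n => Cmod (Csum_lt m (fun r => a r n))).
Proof.
  induction m as [|m IH]; simpl; intros H.
  - exists 0%R. apply filterlim_ext with (fun _ : nat => 0%R); [|apply filterlim_const].
    intros k. rewrite (sum_n_ext _ (fun _ => 0%R)); [rewrite sum_n_const; ring|].
    intros; apply Cmod_0.
  - apply ex_series_Cmod_plus; [apply IH; intros; apply H; lia | apply H; lia].
Qed.

(** * Row sums as Lambert-type terms *)

Lemma Rpower_div_pow (x : R) (j m : nat) : (0 < x)%R -> (1 <= m)%nat ->
  (Rpower x (INR j / INR m) ^ (2 * m) = x ^ (2 * j))%R.
Proof.
  intros Hx Hm. rewrite <- !Rpower_pow, Rpower_mult by (auto; apply exp_pos).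
  f_equal. rewrite !mult_INR; field. apply not_0_INR; lia.
Qed.

Lemma Rpower_div_mult (x : R) (j m : nat) : (0 < x)%R ->
  (Rpower x (INR j / INR m) * Rpower x (2 * INR j - INR j / INR m) = x ^ (2 * j))%R.
Proof.
  intros Hx. rewrite <- Rpower_plus, <- Rpower_pow by auto.
  f_equal. rewrite mult_INR; simpl (INR 2); ring.
Qed.

(** The fractional power is chosen so that the [2m]-th power is [c^(2m)] times the integer power
    [(S k)^(2j)]. Rows use [m = M], [j = N]; columns use the reverse. *)
Definition lambert_arg (m j : nat) (c : C) (k : nat) : C :=
  Rpower (INR (S k)) (INR j / INR m) * c.

(** The value that [coth_power_sum] gives to the inner sum at [w = lambert_arg m j c k]. *)
Definition lambert_row (m j : nat) (c : C) (k : nat) : C :=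
  (INR m - PI * lambert_arg m j c k * coth_sum m (lambert_arg m j c k))
  / (2 * INR m * ((-1) ^ m * lambert_arg m j c k ^ (2 * m))).

Lemma lambert_arg_pow (m j : nat) (c : C) (k : nat) : (1 <= m)%nat ->
  lambert_arg m j c k ^ (2 * m) = c ^ (2 * m) * INR (S k) ^ (2 * j).
Proof.
  intros Hm. unfold lambert_arg.
  rewrite Cpow_mult_l, <- RtoC_pow, Rpower_div_pow, RtoC_pow by (auto; apply lt_0_INR; lia).
  ring.
Qed.

Definition lambert_den (m j : nat) (c : C) (r k : nat) : C :=
  Cexp (2 * (PI * (lambert_arg m j c k * half_root m r))) - 1.

Definition weighted_inv (m j : nat) (p : nat -> C) (k : nat) : C :=
  / (Rpower (INR (S k)) (2 * INR j - INR j / INR m) * p k).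

Definition lambert_inv (m j : nat) (c : C) (p : nat -> C) (r k : nat) : C :=
  / (Rpower (INR (S k)) (2 * INR j - INR j / INR m) * p k * lambert_den m j c r k).

(** What the term [INR m] in the numerator of [lambert_row] leaves after division by [p k]; its sum
    produces the even zeta value. *)
Definition pow_inv_term (j : nat) (p : nat -> C) (k : nat) : C :=
  / (INR (S k) ^ (2 * j) * p k).

Section LambertRow.

Variables (m j : nat) (c : C) (p : nat -> C).
Hypotheses (hm : (1 <= m)%nat) (hc : c <> 0) (hp : forall k, p k <> 0)
  (hlam : forall r k, (r < m)%nat -> lambert_den m j c r k <> 0).

Lemma lambert_row_sum (k : nat) :
  is_Cseries (fun n => / (INR (S n) ^ (2 * m) - (-1) ^ m * lambert_arg m j c k ^ (2 * m)))
    (lambert_row m j c k).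
Proof.
  apply coth_power_sum; auto. intros r Hr; apply Csinh_neq_0, hlam; auto.
Qed.

(** The numerator of [lambert_row] contains [k^(j/m)] and its denominator [k^(2j)], with [k]
    standing for [S k]; the quotient is the weight [k^(2j - j/m)] of the series in the theorem. *)
Lemma lambert_row_div (k : nat) :
  / p k * lambert_row m j c k = (-1) ^ m / c ^ (2 * m) *
    (/ 2 * pow_inv_term j p k + (- (PI / INR m * c)) *
       (/ (1 - Cexp (Ci * PI / INR m)) * weighted_inv m j p k
        + Csum_lt m (fun r => half_root m r * lambert_inv m j c p r k))).
Proof.
  unfold lambert_row. rewrite coth_sum_exp by (auto; intros r Hr; exact (hlam r k Hr)).
  rewrite lambert_arg_pow by auto.
  assert (Hw := Cexp_Ci_PI_div_neq_1 m hm).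
  assert (Hm := INR_pos_neq_0 m hm).
  assert (Hx : (0 < INR (S k))%R) by (apply lt_0_INR; lia).
  assert (HY : RtoC (INR (S k)) ^ (2 * j) <> 0) by apply Cpow_nz, INR_S_neq_0.
  assert (Hcm : c ^ (2 * m) <> 0) by now apply Cpow_nz.
  set (g := RtoC (Rpower (INR (S k)) (2 * INR j - INR j / INR m))).
  assert (Hg : g <> 0).
  { intros E; apply RtoC_inj in E. assert (H := exp_pos
      ((2 * INR j - INR j / INR m) * ln (INR (S k)))). unfold Rpower in E; lra. }
  assert (HY' : RtoC (Rpower (INR (S k)) (INR j / INR m)) * g = INR (S k) ^ (2 * j)).
  { unfold g. rewrite <- RtoC_mult, Rpower_div_mult, RtoC_pow; auto. }
  assert (Hs : (-1) ^ m * (-1) ^ m = 1).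
  { rewrite <- Cpow_mult_l. replace (-1 * -1) with (RtoC 1) by ring. apply Cpow_1_l. }
  assert (Hs0 : (-1) ^ m <> 0).
  { intros E. rewrite E, Cmult_0_l in Hs. symmetry in Hs; now apply C1_nz. }
  assert (Hpk := hp k).
  set (sg := (-1) ^ m) in *. clearbody sg.
  set (cm := c ^ (2 * m)) in *. clearbody cm.
  rewrite (Csum_lt_ext m (fun r => half_root m r * lambert_inv m j c p r k)
    (fun r => / (g * p k) * (half_root m r /
       (Cexp (2 * (PI * (lambert_arg m j c k * half_root m r))) - 1)))).
  2:{ intros r Hr. assert (Hl := hlam r k Hr). unfold lambert_inv; fold g.
      change (Cexp (2 * (PI * (lambert_arg m j c k * half_root m r))) - 1) with (lambert_den m j c r k).
      field; auto. }
  rewrite Csum_lt_scal.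
  set (sm := Csum_lt m _). clearbody sm. unfold weighted_inv, pow_inv_term, lambert_arg; fold g.
  rewrite <- HY'.
  assert (HG : RtoC (Rpower (INR (S k)) (INR j / INR m)) <> 0).
  { intros E; rewrite E, Cmult_0_l in HY'; auto. }
  set (G := RtoC (Rpower (INR (S k)) (INR j / INR m))) in *. clearbody G.
  set (om := Cexp (Ci * PI / INR m)) in *. clearbody om.
  (* The sign is in the denominator on the left and in the numerator on the right, and [field] does
     not know that its square is [1]. *)
  replace sg with (/ sg) at 2.
  - field; repeat split; auto using C2_neq_0.
  - replace (/ sg) with (sg * sg / sg) by (rewrite Hs; field; auto). field; auto.
Qed.

Hypothesis hp_sum : ex_series (fun k => Cmod (/ p k)).
Hypothesis hs1 : ex_series (fun k => Cmod (weighted_inv m j p k)).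
Hypothesis hs2 : forall r, (r < m)%nat -> ex_series (fun k => Cmod (lambert_inv m j c p r k)).

Lemma lambert_q_abs : ex_series (fun k => Cmod (pow_inv_term j p k)).
Proof.
  apply ex_series_Cmod_le with (2 := hp_sum). intros k; unfold pow_inv_term.
  assert (HY : RtoC (INR (S k)) ^ (2 * j) <> 0) by apply Cpow_nz, INR_S_neq_0.
  rewrite Cmod_inv by (apply Cmult_neq_0; auto).
  rewrite Cmod_inv, Cmod_mult by auto.
  assert (H1 : (1 <= INR (S k))%R) by (apply (le_INR 1); lia).
  assert (H : (1 <= Cmod (RtoC (INR (S k)) ^ (2 * j)))%R).
  { rewrite Cmod_pow, Cmod_R, Rabs_pos_eq by lra. now apply pow_R1_Rle. }
  assert (H0 := proj1 (Cmod_gt_0 (p k)) (hp k)).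
  apply Rinv_le_contravar; auto. nra.
Qed.

(** This is where the assumed absolute convergence of the plain and Lambert-type series makes the
    row sums summable against [1 / p k]. *)
Lemma lambert_row_abs : ex_series (fun k => Cmod (/ p k * lambert_row m j c k)).
Proof.
  apply ex_series_Cmod_ext with (1 := fun k => eq_sym (lambert_row_div k)).
  apply ex_series_Cmod_scal, ex_series_Cmod_plus.
  - apply ex_series_Cmod_scal, lambert_q_abs.
  - apply ex_series_Cmod_scal, ex_series_Cmod_plus.
    + now apply ex_series_Cmod_scal.
    + apply (ex_series_Cmod_Csum_lt m (fun r k => half_root m r * lambert_inv m j c p r k)).
      intros r Hr; apply ex_series_Cmod_scal; auto.
Qed.

Lemma lambert_row_total :
  is_Cseries (fun k => / p k * lambert_row m j c k) ((-1) ^ m / c ^ (2 * m) *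
    (/ 2 * CSeries (pow_inv_term j p) + (- (PI / INR m * c)) *
       (/ (1 - Cexp (Ci * PI / INR m)) * CSeries (weighted_inv m j p)
        + Csum_lt m (fun r => half_root m r * CSeries (lambert_inv m j c p r))))).
Proof.
  apply is_Cseries_ext with (1 := fun k => eq_sym (lambert_row_div k)).
  apply is_Cseries_scal, is_Cseries_plus.
  - apply is_Cseries_scal, is_Cseries_abs, lambert_q_abs.
  - apply is_Cseries_scal, is_Cseries_plus.
    + now apply is_Cseries_scal, is_Cseries_abs.
    + apply (is_Cseries_Csum_lt m (fun r k => half_root m r * lambert_inv m j c p r k)
        (fun r => half_root m r * CSeries (lambert_inv m j c p r))).
      intros r Hr; apply is_Cseries_scal, is_Cseries_abs; auto.
Qed.

End LambertRow.

(** * Integer powers, signs, and the exchange of summations *)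

Lemma Cpowz_of_nat (x : C) (n : nat) : Cpowz x (Z.of_nat n) = x ^ n.
Proof. destruct n; [reflexivity|]. cbn [Cpowz Z.of_nat]. now rewrite SuccNat2Pos.id_succ. Qed.

(** Every integer exponent of the theorem is a difference of naturals, some of them negative; the
    quotient form makes them accessible to [field]. *)
Lemma Cpowz_sub (x : C) (a b : nat) : x <> 0 ->
  Cpowz x (Z.of_nat a - Z.of_nat b) = x ^ a / x ^ b.
Proof.
  intros Hx. destruct (le_lt_dec b a) as [H|H].
  - rewrite <- Nat2Z.inj_sub, Cpowz_of_nat by auto.
    replace (x ^ a) with (x ^ (a - b) * x ^ b) by (rewrite <- Cpow_add_r; f_equal; lia).
    field. now apply Cpow_nz.
  - replace (Z.of_nat a - Z.of_nat b)%Z with (- Z.of_nat (b - a))%Z by lia.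
    replace (x ^ b) with (x ^ a * x ^ (b - a)) by (rewrite <- Cpow_add_r; f_equal; lia).
    assert (Hab : (0 < b - a)%nat) by lia.
    replace (Cpowz x (- Z.of_nat (b - a))) with (/ x ^ (b - a)).
    + field. split; now apply Cpow_nz.
    + destruct (b - a)%nat as [|d]; [lia|].
      cbn [Cpowz Z.of_nat Z.opp]. now rewrite SuccNat2Pos.id_succ.
Qed.

Lemma Cdiv_neq_0 (a b : C) : a <> 0 -> b <> 0 -> a / b <> 0.
Proof.
  intros Ha Hb E. apply Ha. replace a with (a / b * b) by (field; auto).
  rewrite E; ring.
Qed.

Lemma Cpow_m1_sqr (m : nat) : (-1) ^ m * (-1) ^ m = 1.
Proof.
  rewrite <- Cpow_mult_l. replace (-1 * -1) with (RtoC 1) by ring. apply Cpow_1_l.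
Qed.

Lemma Cpow_m1_pred (m : nat) : (1 <= m)%nat -> (-1) ^ (m - 1) = - (-1) ^ m.
Proof.
  intros H. replace m with (S (m - 1)) at 2 by lia. rewrite Cpow_S; ring.
Qed.

(* Only the part [1 / (P_k (n ^ (2m) - z_k))] of the decomposition of [1 / (P_k Q_n)] is
   known to be absolutely summable beforehand, hence the asymmetric hypotheses. *)
Lemma partial_fraction_exchange (m j : nat) (P Q y z row col : nat -> C) (SP SQ SR : C) :
  (1 <= m)%nat ->
  (forall k, P k <> 0) -> (forall n, Q n <> 0) ->
  (forall k n, INR (S n) ^ (2 * m) - z k <> 0) ->
  (forall k n, INR (S k) ^ (2 * j) - y n <> 0) ->
  (forall k n, / P k * / (INR (S n) ^ (2 * m) - z k)
             + / Q n * / (INR (S k) ^ (2 * j) - y n) = / P k * / Q n) ->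
  (forall k, is_Cseries (fun n => / (INR (S n) ^ (2 * m) - z k)) (row k)) ->
  (forall n, is_Cseries (fun k => / (INR (S k) ^ (2 * j) - y n)) (col n)) ->
  ex_series (fun k => Cmod (/ P k)) ->
  ex_series (fun k => Cmod (/ P k * row k)) ->
  is_Cseries (fun k => / P k) SP -> is_Cseries (fun n => / Q n) SQ ->
  is_Cseries (fun k => / P k * row k) SR ->
  is_Cseries (fun n => / Q n * col n) (SP * SQ - SR).
Proof.
  intros Hm HP HQ Hz Hy Hpf Hrow Hcol HPs HRs HSP HSQ HSR.
  destruct (double_series_bounded m (fun k => / P k) z row Hm Hz Hrow HPs HRs) as [b Hb].
  destruct (fubini_C _ b Hb) as [r [c [l [Hr [Hc [Hrl Hcl]]]]]].
  assert (El : l = SR).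
  { apply (is_Cseries_unique r); auto.
    apply is_Cseries_ext with (2 := HSR). intros k.
    apply (is_Cseries_unique _ _ _ (is_Cseries_scal (/ P k) _ _ (Hrow k)) (Hr k)). }
  (* Within column [n] the second part is [1 / (P_k Q_n)] minus the first part, and both of these
     have known sums over [k]. *)
  assert (Hn : forall n, / Q n * col n = SP * / Q n + -1 * c n).
  { intros n.
    apply (is_Cseries_unique (fun k => / Q n * / (INR (S k) ^ (2 * j) - y n))).
    - apply is_Cseries_scal, Hcol.
    - rewrite (Cmult_comm SP).
      eapply is_Cseries_ext; [|apply is_Cseries_plus;
        [exact (is_Cseries_scal (/ Q n) _ _ HSP) | exact (is_Cseries_scal (-1) _ _ (Hc n))]].
      intros k; cbv beta. rewrite (Cmult_comm (/ Q n) (/ P k)), <- Hpf. ring. }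
  apply is_Cseries_ext with (1 := fun n => eq_sym (Hn n)).
  replace (SP * SQ - SR) with (SP * SQ + -1 * l) by (rewrite El; ring).
  apply is_Cseries_plus; now apply is_Cseries_scal.
Qed.

Lemma is_Cseries_even_zeta (m : nat) : (1 <= m)%nat ->
  is_Cseries (fun n => / INR (S n) ^ (2 * m)) (RtoC (even_zeta m)).
Proof.
  intros Hm. apply is_Cseries_ext with (2 := is_Cseries_RtoC _ _ (even_zeta_correct m Hm)).
  intros n. rewrite RtoC_inv, RtoC_pow; auto.
  apply pow_nonzero, not_0_INR; lia.
Qed.

(* Since [1 / (X (X - tau)) = (1 / (X - tau) - 1 / X) / tau]. *)
Lemma pow_inv_term_sum (m : nat) (tau : C) (p : nat -> C) (SP : C) : (1 <= m)%nat -> tau <> 0 ->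
  (forall n, p n = INR (S n) ^ (2 * m) - tau) -> (forall n, p n <> 0) ->
  is_Cseries (fun n => / p n) SP ->
  CSeries (pow_inv_term m p) = (SP - even_zeta m) / tau.
Proof.
  intros Hm Ht Ep Hp HP. apply CSeries_unique.
  assert (H := is_Cseries_scal (/ tau) _ _
    (is_Cseries_plus _ _ _ _ HP (is_Cseries_scal (-1) _ _ (is_Cseries_even_zeta m Hm)))).
  replace ((SP - even_zeta m) / tau) with (/ tau * (SP + -1 * even_zeta m)) by (field; auto).
  eapply is_Cseries_ext; [|exact H].
  intros n; cbv beta. unfold pow_inv_term.
  assert (HX : RtoC (INR (S n)) ^ (2 * m) <> 0) by apply Cpow_nz, INR_S_neq_0.
  assert (H1 := Hp n). rewrite Ep in *.
  set (X := RtoC (INR (S n)) ^ (2 * m)) in *. clearbody X. field; auto.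
Qed.

Lemma ex_series_abs_shift (m : nat) (tau : C) (p : nat -> C) : (1 <= m)%nat ->
  (forall n, p n = INR (S n) ^ (2 * m) - tau) -> (forall n, p n <> 0) ->
  ex_series (fun n => Cmod (/ p n)).
Proof.
  intros Hm Ep Hp.
  apply (ex_series_Cmod_ext (fun n => / (INR (S n) ^ (2 * m) - tau)));
    [intros n; now rewrite Ep|].
  apply ex_series_inv_shift; [lia|].
  intros n E. apply (Hp n). rewrite Ep, E; ring.
Qed.

(** * Matching with the terms of the theorem *)

Lemma CSeries_ext (a b : nat -> C) : (forall n, a n = b n) -> CSeries a = CSeries b.
Proof.
  intros H; unfold CSeries; f_equal; apply Series_ext; intros n; now rewrite H.
Qed.

(** Its [2N]-th power is [(-1)^(M - N)], which changes the sign [(-1)^N] of the column sums into the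
    sign [(-1)^M] that goes with [Q_n]. *)
Definition twist (M N : nat) : C := Cexp (Ci * PI * (INR M - INR N) / (2 * INR N)).

Lemma twist_pow (M N : nat) : (1 <= N)%nat ->
  (-1) ^ N * twist M N ^ (2 * N) = (-1) ^ M.
Proof.
  intros HN. rewrite <- Cexp_Ci_PI, !Cexp_pow. unfold twist.
  rewrite Cexp_pow, <- Cexp_plus. f_equal.
  rewrite mult_INR, RtoC_mult. simpl (INR 2).
  replace (RtoC (1 + 1)) with (RtoC 2) by (f_equal; ring).
  assert (H := INR_pos_neq_0 N HN). field; auto using C2_neq_0.
Qed.

Lemma lambert_den_1 (M N : nat) (x1 x2 : C) (r k : nat) :
  lambert_den M N (x2 ^ N / x1 ^ N) r k = lambert1 M N x1 x2 r (S k).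
Proof.
  unfold lambert_den, lambert1, lambert_arg, half_root. f_equal; f_equal. ring.
Qed.

Lemma lambert_den_2 (M N : nat) (x1 x2 : C) (r k : nat) : (1 <= N)%nat ->
  lambert_den N M (twist M N * (x1 ^ M / x2 ^ M)) r k = lambert2 M N x1 x2 r (S k).
Proof.
  intros HN. unfold lambert_den, lambert2, lambert_arg, half_root.
  replace (Cexp (Ci * PI / INR N * (INR r + INR M / 2 - INR N / 2)))
    with (Cexp (Ci * INR r * PI / INR N) * twist M N).
  - f_equal; f_equal. ring.
  - unfold twist; rewrite <- Cexp_plus; f_equal.
    assert (H := INR_pos_neq_0 N HN). field; auto using C2_neq_0.
Qed.

Theorem proposition20 (B : nat -> R) (hB : is_bernoulli B)
    (M N : nat) (hN : (1 <= N)%nat) (hNM : (N <= M)%nat)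
    (x1 x2 : C) (hx1 : x1 <> 0) (hx2 : x2 <> 0)
    (hx : forall n k : nat, (1 <= n)%nat -> (1 <= k)%nat ->
       x1 ^ (2 * M * N) * INR n ^ (2 * M)
       + (-1) ^ (M - 1) * x2 ^ (2 * M * N) * INR k ^ (2 * N) <> 0)
    (t : C) (ht : terms_defined M N x1 x2 t)
    (hconv : lhs_abs_convergent M N x1 x2 t) :
  let zM := Z.of_nat M in
  let zN := Z.of_nat N in
  PI * Cpowz x2 (zN - 2 * zM * zN)
    / (INR M * Cpowz x1 (zN - 2 * zM * zN) * (1 - Cexp (Ci * PI / INR M)))
    * Csum_ge1 (summand1 M N x2 t)
  + PI * Cpowz x2 (zN - 2 * zM * zN) / (INR M * Cpowz x1 (zN - 2 * zM * zN))
    * Csum_lt M (fun r => Cexp (Ci * INR r * PI / INR M)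
                          * Csum_ge1 (summand2 M N x1 x2 t r))
  + Cexp (Ci * PI * (INR M - INR N) / (2 * INR N))
    * (PI * Cpowz x1 (zM - 2 * zM * zN)
       / (INR N * Cpowz x2 (zM - 2 * zM * zN) * (1 - Cexp (Ci * PI / INR N))))
    * Csum_ge1 (summand3 M N x1 t)
  + Cexp (Ci * PI * (INR M - INR N) / (2 * INR N))
    * (PI * Cpowz x1 (zM - 2 * zM * zN) / (INR N * Cpowz x2 (zM - 2 * zM * zN)))
    * Csum_lt N (fun r => Cexp (Ci * INR r * PI / INR N)
                          * Csum_ge1 (summand4 M N x1 x2 t r))
  = x1 ^ (2 * M * N) * x2 ^ (2 * M * N) / (4 * t ^ (4 * M * N))
    + x2 ^ (2 * M * N) * (2 * PI) ^ (2 * M) * B (2 * M)%nat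
      / (4 * t ^ (2 * M * N) * INR (fact (2 * M)))
    + x1 ^ (2 * M * N) * (-1) ^ N * (2 * PI) ^ (2 * N) * B (2 * N)%nat
      / (4 * t ^ (2 * M * N) * INR (fact (2 * N)))
    - PI ^ 2 * Cpowz x1 (2 * zM * zN - zN) * Cpowz x2 (2 * zM * zN - zM)
      / (4 * INR M * INR N * Cpowz t (4 * zM * zN - zN - zM))
      * (Csum_lt M (fun r => Cexp (Ci * INR r * PI / INR M)
                             * Ccoth (coth_arg M N x1 t r))
         * Csum_lt N (fun r => Cexp (Ci * INR r * PI / INR N)
                               * Ccot (cot_arg M N x2 t r))).
Proof.
  intros zM zN.
  assert (hM : (1 <= M)%nat) by lia.
  destruct ht as [Ht HP HQ Hl1 Hl2 Hcoth Hcot].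
  destruct hconv as [A1 A2 A3 A4].
  set (c1 := x2 ^ N / x1 ^ N). set (c2 := twist M N * (x1 ^ M / x2 ^ M)).
  set (P := fun k => pole1 M N x2 t (S k)). set (Q := fun n => pole2 M N x1 t (S n)).
  assert (HP' : forall k, P k <> 0) by (intros; apply HP; lia).
  assert (HQ' : forall k, Q k <> 0) by (intros; apply HQ; lia).
  assert (nM := INR_pos_neq_0 M hM). assert (nN := INR_pos_neq_0 N hN).
  assert (nPI : RtoC PI <> 0).
  { assert (H := PI_RGT_0). intros E; apply RtoC_inj in E; lra. }
  assert (n4 : RtoC 4 <> 0) by (intros E; apply RtoC_inj in E; lra).
  assert (n2 := C2_neq_0).
  assert (nomM := Cexp_Ci_PI_div_neq_1 M hM). assert (nomN := Cexp_Ci_PI_div_neq_1 N hN).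
  assert (ntw : twist M N <> 0) by apply Cexp_neq_0.
  assert (Hss := Cpow_m1_sqr M). assert (HssN := Cpow_m1_sqr N).
  assert (Htw := twist_pow M N hN).
  assert (Hpred := Cpow_m1_pred M hM).
  assert (na1 : x1 ^ N <> 0) by now apply Cpow_nz.
  assert (na2 : x2 ^ N <> 0) by now apply Cpow_nz.
  assert (nb1 : x1 ^ M <> 0) by now apply Cpow_nz.
  assert (nb2 : x2 ^ M <> 0) by now apply Cpow_nz.
  assert (ntn : t ^ N <> 0) by now apply Cpow_nz.
  assert (ntm : t ^ M <> 0) by now apply Cpow_nz.
  assert (nal : x1 ^ (2 * M * N) <> 0) by now apply Cpow_nz.
  assert (nbe : x2 ^ (2 * M * N) <> 0) by now apply Cpow_nz.
  assert (nT : t ^ (2 * M * N) <> 0) by now apply Cpow_nz.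
  assert (EpM : forall a : C, (a ^ M) ^ (2 * N) = a ^ (2 * M * N))
    by (intros; rewrite <- Cpow_mult_r; f_equal; lia).
  assert (EpN : forall a : C, (a ^ N) ^ (2 * M) = a ^ (2 * M * N))
    by (intros; rewrite <- Cpow_mult_r; f_equal; lia).
  assert (Ediv : forall (a b : C) n, b <> 0 -> (a / b) ^ n = a ^ n / b ^ n)
    by (intros; unfold Cdiv; rewrite Cpow_mult_l, Cpow_inv; auto).
  assert (Ec1 : c1 ^ (2 * M) = x2 ^ (2 * M * N) / x1 ^ (2 * M * N))
    by (unfold c1; rewrite Ediv, !EpN; auto).
  assert (Ec2 : (-1) ^ N * c2 ^ (2 * N)
                = (-1) ^ M * (x1 ^ (2 * M * N) / x2 ^ (2 * M * N))).
  { unfold c2. rewrite Cpow_mult_l, Cmult_assoc, Htw, Ediv, !EpM; auto. }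
  assert (nc1 : c1 <> 0) by (now apply Cdiv_neq_0).
  assert (nc2 : c2 <> 0).
  { apply Cmult_neq_0; auto. now apply Cdiv_neq_0. }
  assert (Hden1 : forall r k, (r < M)%nat -> lambert_den M N c1 r k <> 0).
  { intros r k Hr. unfold c1. rewrite lambert_den_1. apply Hl1; auto; lia. }
  assert (Hden2 : forall r k, (r < N)%nat -> lambert_den N M c2 r k <> 0).
  { intros r k Hr. unfold c2. rewrite lambert_den_2 by auto. apply Hl2; auto; lia. }
  assert (Es1 : forall n, summand1 M N x2 t (S n) = weighted_inv M N P n).
  { intros n. unfold summand1, weighted_inv, P, Cdiv. ring. }
  assert (Es2 : forall r n, summand2 M N x1 x2 t r (S n) = lambert_inv M N c1 P r n).
  { intros r n. unfold summand2, lambert_inv, c1. rewrite lambert_den_1. unfold P, Cdiv. ring. }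
  assert (Es3 : forall n, summand3 M N x1 t (S n) = weighted_inv N M Q n).
  { intros n. unfold summand3, weighted_inv, Q, Cdiv. ring. }
  assert (Es4 : forall r n, summand4 M N x1 x2 t r (S n) = lambert_inv N M c2 Q r n).
  { intros r n. unfold summand4, lambert_inv, c2. rewrite lambert_den_2 by auto.
    unfold Q, Cdiv. ring. }
  unfold Csum_ge1.
  rewrite (CSeries_ext _ _ Es1), (CSeries_ext _ _ Es3).
  rewrite (Csum_lt_ext M (fun r => _ * CSeries (fun n => summand2 M N x1 x2 t r (S n)))
    (fun r => half_root M r * CSeries (lambert_inv M N c1 P r)))
    by (intros r _; now rewrite (CSeries_ext _ _ (Es2 r))).
  rewrite (Csum_lt_ext N (fun r => _ * CSeries (fun n => summand4 M N x1 x2 t r (S n)))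
    (fun r => half_root N r * CSeries (lambert_inv N M c2 Q r)))
    by (intros r _; now rewrite (CSeries_ext _ _ (Es4 r))).
  assert (EP : forall k, P k = INR (S k) ^ (2 * N) - t ^ (2 * M * N) / x2 ^ (2 * M * N))
    by reflexivity.
  assert (EQ : forall n, Q n = INR (S n) ^ (2 * M)
     - (-1) ^ M * (t ^ (2 * M * N) / x1 ^ (2 * M * N))).
  { intros n. unfold Q, pole2. rewrite Hpred; ring. }
  assert (ns : (-1) ^ M <> 0).
  { intros E. rewrite E, Cmult_0_l in Hss. symmetry in Hss; now apply C1_nz. }
  assert (nsN : (-1) ^ N <> 0).
  { intros E. rewrite E, Cmult_0_l in HssN. symmetry in HssN; now apply C1_nz. }
  assert (AP := ex_series_abs_shift N _ P hN EP HP').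
  assert (AQ := ex_series_abs_shift M _ Q hM EQ HQ').
  assert (ntp : t ^ (2 * M * N) / x2 ^ (2 * M * N) <> 0).
  { now apply Cdiv_neq_0. }
  assert (ntq : (-1) ^ M * (t ^ (2 * M * N) / x1 ^ (2 * M * N)) <> 0).
  { apply Cmult_neq_0; auto. now apply Cdiv_neq_0. }
  assert (SP := is_Cseries_abs _ AP). assert (SQ := is_Cseries_abs _ AQ).
  set (sP := CSeries (fun k => / P k)) in *. set (sQ := CSeries (fun n => / Q n)) in *.
  assert (Eq1 := pow_inv_term_sum N _ P sP hN ntp EP HP' SP).
  assert (Eq2 := pow_inv_term_sum M _ Q sQ hM ntq EQ HQ' SQ).
  assert (A1' : ex_series (fun k => Cmod (weighted_inv M N P k)))
    by exact (ex_series_Cmod_ext _ _ Es1 A1).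
  assert (A2' : forall r, (r < M)%nat -> ex_series (fun k => Cmod (lambert_inv M N c1 P r k)))
    by (intros r Hr; exact (ex_series_Cmod_ext _ _ (Es2 r) (A2 r Hr))).
  assert (A3' : ex_series (fun k => Cmod (weighted_inv N M Q k)))
    by exact (ex_series_Cmod_ext _ _ Es3 A3).
  assert (A4' : forall r, (r < N)%nat -> ex_series (fun k => Cmod (lambert_inv N M c2 Q r k)))
    by (intros r Hr; exact (ex_series_Cmod_ext _ _ (Es4 r) (A4 r Hr))).
  assert (Rtot := lambert_row_total M N c1 P hM nc1 HP' Hden1 AP A1' A2').
  assert (Ctot := lambert_row_total N M c2 Q hN nc2 HQ' Hden2 AQ A3' A4').
  assert (Ez : forall k, (-1) ^ M * lambert_arg M N c1 k ^ (2 * M)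
    = (-1) ^ M * (x2 ^ (2 * M * N) / x1 ^ (2 * M * N)) * INR (S k) ^ (2 * N)).
  { intros k. rewrite lambert_arg_pow, Ec1 by auto. ring. }
  assert (Ey : forall n, (-1) ^ N * lambert_arg N M c2 n ^ (2 * N)
    = (-1) ^ M * (x1 ^ (2 * M * N) / x2 ^ (2 * M * N)) * INR (S n) ^ (2 * M)).
  { intros n. rewrite lambert_arg_pow by auto. rewrite Cmult_assoc, Ec2. ring. }
  (* The nonvanishing hypothesis, with [(-1)^(M - 1)] rewritten as [-(-1)^M]. Up to nonzero factors,
     this one quantity is the denominator of both parts ([ED1], [ED2]). *)
  assert (HD : forall n k, x1 ^ (2 * M * N) * INR (S n) ^ (2 * M)
    - (-1) ^ M * x2 ^ (2 * M * N) * INR (S k) ^ (2 * N) <> 0).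
  { intros n k E. apply (hx (S n) (S k)); [lia | lia |].
    rewrite Hpred, <- E. ring. }
  assert (ED1 : forall k n, INR (S n) ^ (2 * M) - (-1) ^ M * lambert_arg M N c1 k ^ (2 * M)
    = (x1 ^ (2 * M * N) * INR (S n) ^ (2 * M)
       - (-1) ^ M * x2 ^ (2 * M * N) * INR (S k) ^ (2 * N)) / x1 ^ (2 * M * N)).
  { intros k n. rewrite Ez. field; auto. }
  assert (ED2 : forall k n, INR (S k) ^ (2 * N) - (-1) ^ N * lambert_arg N M c2 n ^ (2 * N)
    = - (-1) ^ M * (x1 ^ (2 * M * N) * INR (S n) ^ (2 * M)
       - (-1) ^ M * x2 ^ (2 * M * N) * INR (S k) ^ (2 * N)) / x2 ^ (2 * M * N)).
  { intros k n. rewrite Ey.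
    transitivity ((- (-1) ^ M * (x1 ^ (2 * M * N) * INR (S n) ^ (2 * M))
      + (-1) ^ M * (-1) ^ M * x2 ^ (2 * M * N) * INR (S k) ^ (2 * N)) / x2 ^ (2 * M * N)).
    - rewrite Hss. field; auto.
    - field; auto. }
  assert (nz : forall k n, INR (S n) ^ (2 * M) - (-1) ^ M * lambert_arg M N c1 k ^ (2 * M) <> 0).
  { intros k n. rewrite ED1. apply Cdiv_neq_0; auto. }
  assert (ny : forall k n, INR (S k) ^ (2 * N) - (-1) ^ N * lambert_arg N M c2 n ^ (2 * N) <> 0).
  { intros k n. rewrite ED2. apply Cdiv_neq_0; auto. apply Cmult_neq_0; auto.
    intros E. apply ns. replace ((-1) ^ M) with (- - (-1) ^ M) by ring. rewrite E; ring. }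
  assert (Epf : forall k n,
    / P k * / (INR (S n) ^ (2 * M) - (-1) ^ M * lambert_arg M N c1 k ^ (2 * M))
    + / Q n * / (INR (S k) ^ (2 * N) - (-1) ^ N * lambert_arg N M c2 n ^ (2 * N))
    = / P k * / Q n).
  { intros k n. rewrite ED1, ED2. assert (HDnk := HD n k).
    (* The terms in [t] cancel, so the common denominator is a linear combination of [P k] and
       [Q n]; this is what makes the partial fraction identity work. *)
    assert (ED : x1 ^ (2 * M * N) * INR (S n) ^ (2 * M)
       - (-1) ^ M * x2 ^ (2 * M * N) * INR (S k) ^ (2 * N)
       = x1 ^ (2 * M * N) * Q n - (-1) ^ M * x2 ^ (2 * M * N) * P k).
    { rewrite EP, EQ. field; auto. }
    rewrite ED in *. assert (H1 := HP' k). assert (H2 := HQ' n).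
    set (p := P k) in *. set (q := Q n) in *. clearbody p q.
    set (sg := (-1) ^ M) in *. set (al := x1 ^ (2 * M * N)) in *.
    set (be := x2 ^ (2 * M * N)) in *. clearbody sg al be.
    transitivity (/ p * / q * (al * q - sg * sg * (/ sg * be * p)) / (al * q - sg * be * p)).
    - rewrite Hss. field. repeat split; auto.
    - field. repeat split; auto. }
  assert (Ex := partial_fraction_exchange M N P Q
    (fun n => (-1) ^ N * lambert_arg N M c2 n ^ (2 * N))
    (fun k => (-1) ^ M * lambert_arg M N c1 k ^ (2 * M))
    (lambert_row M N c1) (lambert_row N M c2) sP sQ _ hM HP' HQ'
    nz ny Epf (lambert_row_sum M N c1 hM Hden1) (lambert_row_sum N M c2 hN Hden2)
    AP (lambert_row_abs M N c1 P hM nc1 HP' Hden1 AP A1' A2') SP SQ Rtot).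
  (* The column total is computed twice, by exchange and by its closed form. All that remains is
     algebra on this scalar identity. *)
  assert (EE := is_Cseries_unique _ _ _ Ex Ctot). clear Ex Ctot Rtot.
  assert (KH : PI * (t ^ N / x1 ^ N) * coth_sum M (t ^ N / x1 ^ N)
    = INR M - 2 * INR M * ((-1) ^ M * (t ^ (2 * M * N) / x1 ^ (2 * M * N))) * sQ).
  { assert (H := coth_power_sum M (t ^ N / x1 ^ N) hM).
    assert (Hw : forall r, (r < M)%nat ->
      Csinh (PI * (t ^ N / x1 ^ N * half_root M r)) <> 0).
    { intros r Hr. replace (PI * (t ^ N / x1 ^ N * half_root M r))
        with (coth_arg M N x1 t r) by (unfold coth_arg, half_root, Cdiv; ring). auto. }
    specialize (H Hw). rewrite Ediv, !EpN in H by auto.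
    assert (E := is_Cseries_unique _ _ _ (is_Cseries_ext _ _ _
      (fun n => f_equal Cinv (EQ n)) SQ) H).
    rewrite E. field; auto. }
  assert (KC : PI * (t ^ M / x2 ^ M) * cot_sum N (t ^ M / x2 ^ M)
    = INR N - 2 * INR N * (t ^ (2 * M * N) / x2 ^ (2 * M * N)) * sP).
  { assert (H := cot_power_sum N (t ^ M / x2 ^ M) hN).
    assert (Hw : forall r, (r < N)%nat ->
      Csin (PI * (t ^ M / x2 ^ M * half_root N r)) <> 0).
    { intros r Hr. replace (PI * (t ^ M / x2 ^ M * half_root N r))
        with (cot_arg M N x2 t r) by (unfold cot_arg, half_root, Cdiv; ring). auto. }
    specialize (H Hw). rewrite Ediv, !EpM in H by auto.
    assert (E := is_Cseries_unique _ _ _ (is_Cseries_ext _ _ _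
      (fun n => f_equal Cinv (EP n)) SP) H).
    rewrite E. field; auto. }
  rewrite (Csum_lt_ext M (fun r => _ * Ccoth (coth_arg M N x1 t r))
    (fun r => half_root M r * Ccoth (PI * (t ^ N / x1 ^ N * half_root M r))))
    by (intros r _; unfold half_root, coth_arg; f_equal; f_equal; unfold Cdiv; ring).
  rewrite (Csum_lt_ext N (fun r => _ * Ccot (cot_arg M N x2 t r))
    (fun r => half_root N r * Ccot (PI * (t ^ M / x2 ^ M * half_root N r))))
    by (intros r _; unfold half_root, cot_arg; f_equal; f_equal; unfold Cdiv; ring).
  fold (coth_sum M (t ^ N / x1 ^ N)). fold (cot_sum N (t ^ M / x2 ^ M)).
  assert (HB : forall m, (1 <= m)%nat ->
    B (2 * m)%nat * (2 * PI) ^ (2 * m) / INR (fact (2 * m)) = 2 * (- (-1) ^ m) * even_zeta m).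
  { intros m Hm. rewrite <- Cpow_m1_pred by auto.
    replace (-1 : C) with (RtoC (-1)) by reflexivity.
    rewrite <- RtoC_mult, <- !RtoC_pow, <- RtoC_mult, <- RtoC_div by apply INR_fact_neq_0.
    rewrite (bernoulli_zeta B hB m Hm), !RtoC_mult. reflexivity. }
  assert (HBM := HB M hM). assert (HBN := HB N hN). clear HB.
  replace (zN - 2 * zM * zN)%Z with (Z.of_nat N - Z.of_nat (2 * M * N))%Z
    by (unfold zM, zN; rewrite !Nat2Z.inj_mul; ring).
  replace (zM - 2 * zM * zN)%Z with (Z.of_nat M - Z.of_nat (2 * M * N))%Z
    by (unfold zM, zN; rewrite !Nat2Z.inj_mul; ring).
  replace (2 * zM * zN - zN)%Z with (Z.of_nat (2 * M * N) - Z.of_nat N)%Z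
    by (unfold zM, zN; rewrite !Nat2Z.inj_mul; ring).
  replace (2 * zM * zN - zM)%Z with (Z.of_nat (2 * M * N) - Z.of_nat M)%Z
    by (unfold zM, zN; rewrite !Nat2Z.inj_mul; ring).
  replace (4 * zM * zN - zN - zM)%Z with (Z.of_nat (4 * M * N) - Z.of_nat (N + M))%Z
    by (unfold zM, zN; rewrite Nat2Z.inj_add, !Nat2Z.inj_mul; ring).
  rewrite !Cpowz_sub, Cpow_add_r by auto.
  replace (4 * M * N)%nat with (2 * M * N + 2 * M * N)%nat by lia.
  rewrite Cpow_add_r.
  fold (twist M N).
  (* The prefactor of the column total, brought to the sign [(-1)^M] of the rows by means of
     [Ec2]. *)
  replace ((-1) ^ N / c2 ^ (2 * N)) with
    ((-1) ^ M * (x2 ^ (2 * M * N) / x1 ^ (2 * M * N))) in EE.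
  2:{ replace (c2 ^ (2 * N)) with ((-1) ^ N * ((-1) ^ N * c2 ^ (2 * N)))
        by (rewrite Cmult_assoc, HssN; ring).
      rewrite Ec2.
      transitivity ((-1) ^ M * (-1) ^ M * (x2 ^ (2 * M * N) / x1 ^ (2 * M * N)) / (-1) ^ M).
      - field; auto.
      - rewrite Hss. field; auto. }
  rewrite Ec1, Eq1, Eq2 in EE.
  set (W1 := Csum_lt M (fun r => half_root M r * CSeries (lambert_inv M N c1 P r))) in *.
  set (W2 := Csum_lt N (fun r => half_root N r * CSeries (lambert_inv N M c2 Q r))) in *.
  set (S1 := CSeries (weighted_inv M N P)) in *. set (S3 := CSeries (weighted_inv N M Q)) in *.
  set (CH := coth_sum M (t ^ N / x1 ^ N)) in *. set (CC := cot_sum N (t ^ M / x2 ^ M)) in *.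
  set (omM := Cexp (Ci * PI / INR M)) in *. set (omN := Cexp (Ci * PI / INR N)) in *.
  unfold c1, c2 in EE.
  set (tw := twist M N) in *.
  set (al := x1 ^ (2 * M * N)) in *. set (be := x2 ^ (2 * M * N)) in *.
  set (T := t ^ (2 * M * N)) in *. set (sg := (-1) ^ M) in *. set (sgN := (-1) ^ N) in *.
  set (zetaM := RtoC (even_zeta M)) in *. set (zetaN := RtoC (even_zeta N)) in *.
  assert (nf : forall m, RtoC (INR (fact m)) <> 0).
  { intros m E; apply RtoC_inj in E. now apply (INR_fact_neq_0 m). }
  assert (nfM := nf (2 * M)%nat). assert (nfN := nf (2 * N)%nat).
  replace (be * (2 * PI) ^ (2 * M) * B (2 * M)%nat / (4 * T * INR (fact (2 * M))))
    with (be / (4 * T) * (2 * - sg * zetaM)) by (rewrite <- HBM; field; auto).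
  replace (al * sgN * (2 * PI) ^ (2 * N) * B (2 * N)%nat / (4 * T * INR (fact (2 * N))))
    with (al / (4 * T) * (- 2 * zetaN)).
  2:{ transitivity (al / (4 * T) * (sgN * (2 * - sgN * zetaN))).
      - replace (sgN * (2 * - sgN * zetaN)) with (- 2 * (sgN * sgN) * zetaN) by ring.
        rewrite HssN; ring.
      - rewrite <- HBN; field; auto. }
  replace (PI ^ 2 * (al / x1 ^ N) * (be / x2 ^ M)
      / (4 * INR M * INR N * (T * T / (t ^ N * t ^ M))) * (CH * CC))
    with (al * be / (4 * INR M * INR N * (T * T))
      * ((PI * (t ^ N / x1 ^ N) * CH) * (PI * (t ^ M / x2 ^ M) * CC)))
    by (field; repeat split; auto).
  rewrite KH, KC.
  (* Expanding the product of [KH] and [KC] cancels the constant [al * be / (4 T^2)] on the right;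
     the zeta values then combine with the linear terms in [sP] and [sQ]. *)
  transitivity (sg * sg * (al / (2 * T) * (sP - zetaN)) + sg * be / (2 * T) * (sQ - zetaM)
    - sg * (sP * sQ)).
  2:{ rewrite Hss. field; repeat split; auto. }
  match type of EE with _ - ?X = ?Y =>
    replace (sP * sQ) with (Y + X) by (rewrite <- EE; ring) end.
  clear EE.
  (* Inserting [sg * sg = 1] balances the powers of [sg], so that [field] succeeds with [sg] treated
     as an indeterminate. *)
  match goal with |- ?L = _ => transitivity (sg * sg * L) end.
  - rewrite Hss; ring.
  - field; repeat split; auto.
Qed.
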